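(* For every integer $n\ge 0$ the following hold. (a) The quotient $$\frac{\mathrm{crank}_{5n+4}(\zeta)}{\Phi_5(\zeta^2)}$$ is a Laurent polynomial in $\zeta$ with non-negative coefficients. (b) The quotients $$\frac{\mathrm{crank}_{5,n}^*(\zeta)}{\Phi_5(\zeta)},\qquad \frac{\mathrm{crank}_{7,n}^*(\zeta)}{\Phi_7(\zeta)},\qquad \frac{\mathrm{crank}_{11,n}^*(\zeta)}{\Phi_{11}(\zeta)}$$ are Laurent polynomials in $\zeta$ with non-negative coefficients.
   Context: For a prime $\ell$, $\Phi_\ell(\zeta):=1+\zeta+\cdots+\zeta^{\ell-1}$. The integers $M(m,n)$ ($m\in\mathbb{Z}$, $n\ge 0$) and the Laurent polynomials $\mathrm{crank}_n(\zeta)$ are defined by $$\sum_{n\ge 0}\mathrm{crank}_n(\zeta)q^n=\sum_{n\ge 0}\sum_{m\in\mathbb{Z}}M(m,n)\zeta^m q^n=\prod_{n=1}^\infty\frac{1-q^n}{(1-\zeta q^n)(1-\zeta^{-1}q^n)}.$$ For $n\ge 2$, $M(m,n)$ is the number of partitions of $n$ with crank $m$, where the crank of a partition $\lambda$ is the largest part of $\lambda$ if $\lambda$ has no parts equal to $1$, and otherwise is $\mu(\lambda)-\omega(\lambda)$, with $\omega(\lambda)$ the number of $1$'s in $\lambda$ and $\mu(\lambda)$ the number of parts of $\lambda$ larger than $\omega(\lambda)$. For $\ell\in\{5,7,11\}$ put $\beta:=\ell-\frac{\ell^2-1}{24}$ (so $\beta=4,5,6$ for $\ell=5,7,11$ respectively).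 The modified crank is, for $n\ge 0$, $$\mathrm{crank}_{\ell,n}^*(\zeta):=\mathrm{crank}_{\ell n+\beta}(\zeta)+\zeta^{\ell n+\beta-\ell}-\zeta^{\ell n+\beta}+\zeta^{\ell-\ell n-\beta}-\zeta^{-\ell n-\beta}.$$ *)

(* Defs.v *)
From mathcomp Require Import all_boot all_order all_algebra.

Set Implicit Arguments.
Unset Strict Implicit.
Unset Printing Implicit Defensive.

Import GRing.Theory.
Local Open Scope ring_scope.

(* Laurent polynomials in zeta with integer coefficients are handled inside
   the field of rational functions Frac(Z[zeta]). *)
Notation ratfun := {fraction {poly int}}.

Definition zeta : ratfun := FracField.tofrac 'X.

Definition laurent_nonneg (f : ratfun) : Prop :=
  exists (p : {poly int}) (d : nat),
    (forall i : nat, 0 <= p`_i) /\ f = FracField.tofrac p / zeta ^+ d.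

Definition Phi (F : fieldType) (l : nat) (z : F) : F := \sum_(i < l) z ^+ i.

(* The expansion of 1 / (1 - z q^k) in powers of q = 'X, truncated after the
   term of index N. *)
Definition geom (F : fieldType) (N k : nat) (z : F) : {poly F} :=
  \sum_(j < N.+1) z ^+ j *: 'X^(j * k).

Definition crank_prod (F : fieldType) (N : nat) (z : F) : {poly F} :=
  \prod_(1 <= k < N.+1) ((1 - 'X^k) * geom N k z * geom N k z^-1).

(* The coefficient of q^n in
     prod_(k >= 1) (1 - q^k) / ((1 - z q^k) (1 - z^-1 q^k)).
   Factors with k > n and terms of geom of index > n do not affect it; see
   crank_prod_stable and crank_gf. *)
Definition crank (F : fieldType) (n : nat) (z : F) : F := (crank_prod n z)`_n.

Definition beta (l : nat) : nat := (l - (l ^ 2 - 1) %/ 24)%N.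

Definition crank_star (F : fieldType) (l n : nat) (z : F) : F :=
  let N := (l * n + beta l)%N in
  crank N z + z ^ (N%:Z - l%:Z) - z ^ N%:Z + z ^ (l%:Z - N%:Z) - z ^ (- N%:Z).

Section Facts.
Variable F : fieldType.
Implicit Types (z : F) (p q r : {poly F}).

Let eqm (m : nat) p q := p %% 'X^m = q %% 'X^m.

Let eqm_trans m q p r : eqm m p q -> eqm m q r -> eqm m p r.
Proof. exact: etrans. Qed.

Let eqmM m p p' q q' : eqm m p p' -> eqm m q q' -> eqm m (p * q) (p' * q').
Proof.
rewrite /eqm => hp hq.
by rewrite -modp_mul hq modp_mul ![_ * q']mulrC -modp_mul hp modp_mul.
Qed.

Let eqm_prod m (s : seq nat) (P : pred nat) (f g : nat -> {poly F}) :
  (forall k, P k -> eqm m (f k) (g k)) ->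
  eqm m (\prod_(k <- s | P k) f k) (\prod_(k <- s | P k) g k).
Proof. by move=> h; elim/big_rec2: _ => // k p q Pk; apply: eqmM; apply: h. Qed.

Let eqm_prod1 m (s : seq nat) (P : pred nat) (f : nat -> {poly F}) :
  (forall k, P k -> eqm m (f k) 1) -> eqm m (\prod_(k <- s | P k) f k) 1.
Proof. by move=> /(@eqm_prod m s P f (fun=> 1)); rewrite big1_eq. Qed.

Let eqmDl m p r : eqm m ('X^m * r + p) p.
Proof. by rewrite /eqm modpD modp_mulr add0r. Qed.

Let eqm_coef m p q i : eqm m p q -> (i < m)%N -> p`_i = q`_i.
Proof.
move=> h im; rewrite (divp_eq p 'X^m) (divp_eq q 'X^m) h !coefD !coefMXn.
by rewrite im.
Qed.

Let eqm_le m m' p q : (m <= m')%N -> eqm m' p q -> eqm m p q.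
Proof.
move=> mm' h; rewrite (divp_eq p 'X^m') (divp_eq q 'X^m') h -(subnKC mm').
by rewrite exprD /eqm !modpD ![_ * ('X^m * _)]mulrCA !modp_mulr !add0r.
Qed.

Lemma geomE N k z :
  (1 - z *: 'X^k) * geom N k z = 1 - z ^+ N.+1 *: 'X^(N.+1 * k).
Proof.
rewrite -[1 in RHS](expr1n _ N.+1).
have -> : z ^+ N.+1 *: 'X^(N.+1 * k) = (z *: 'X^k) ^+ N.+1 :> {poly F}.
  by rewrite exprZn -exprM mulnC.
rewrite subrXX; congr (_ * _); apply: eq_bigr => j _.
by rewrite expr1n mul1r exprZn -exprM mulnC.
Qed.

Let eqm_geom N k z : (0 < k)%N -> eqm N.+1 ((1 - z *: 'X^k) * geom N k z) 1.
Proof.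
move=> k0; rewrite geomE addrC -{1}[(N.+1 * k)%N](@subnKC N.+1); last first.
  by rewrite leq_pmulr.
by rewrite exprD scalerAr -mulrN; apply: eqmDl.
Qed.

Let den z k : {poly F} := (1 - z *: 'X^k) * (1 - z^-1 *: 'X^k).

Let crank_prod_den N z :
  eqm N.+1 (crank_prod N z * \prod_(1 <= k < N.+1) den z k)
           (\prod_(1 <= k < N.+1) (1 - 'X^k)).
Proof.
rewrite -big_split /= big_nat [X in eqm _ _ X]big_nat.
apply: eqm_prod => k /andP[k0 _].
have -> : (1 - 'X^k) * geom N k z * geom N k z^-1 * den z k =
  (1 - 'X^k) * (((1 - z *: 'X^k) * geom N k z) *
                ((1 - z^-1 *: 'X^k) * geom N k z^-1)).
  by rewrite /den mulrACA [_ * (1 - z^-1 *: _)]mulrC -!mulrA;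
     congr (_ * _); rewrite mulrCA.
rewrite -[X in eqm _ _ X]mulr1; apply: eqmM => //.
by rewrite -[X in eqm _ _ X]mulr1; apply: eqmM; apply: eqm_geom.
Qed.

Lemma crank_prod_stable n N i z :
  (n <= N)%N -> (i <= n)%N -> (crank_prod N z)`_i = (crank_prod n z)`_i.
Proof.
move=> nN i_n; apply: (@eqm_coef n.+1); last by rewrite ltnS.
have small k : (n < k)%N -> eqm n.+1 (1 - 'X^k) 1.
  by move=> nk; rewrite -(subnKC nk) exprD -mulrN addrC; apply: eqmDl.
have geom_n m k w : (0 < k)%N -> (n <= m)%N -> eqm n.+1 (geom m k w) (geom n k w).
  move=> k0 nm; pose d : {poly F} := 1 - w *: 'X^k.
  have h j : (n <= j)%N -> eqm n.+1 (d * geom j k w) 1.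
    by move=> nj; apply: (@eqm_le _ j.+1); [rewrite ltnS | apply: eqm_geom].
  rewrite -[geom m k w]mulr1 -[X in eqm _ _ X]mul1r.
  apply: (@eqm_trans _ (geom m k w * (d * geom n k w))).
    by apply: eqmM => //; apply/esym/h.
  by rewrite mulrA [geom m k w * d]mulrC; apply: eqmM => //; apply: h.
have geom_1 k w : (n < k)%N -> eqm n.+1 (geom n k w) 1.
  move=> nk; have k0 := leq_trans (ltn0Sn n) nk.
  rewrite -[geom n k w]mul1r.
  apply: (@eqm_trans _ ((1 - w *: 'X^k) * geom n k w)); last first.
    exact: eqm_geom.
  apply: eqmM => //; apply: esym.
  by rewrite -(subnKC nk) exprD scalerAr -mulrN addrC; apply: eqmDl.
rewrite /crank_prod (@big_cat_nat _ _ _ n.+1) //=.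
rewrite -[X in eqm _ _ X]mulr1; apply: eqmM.
  rewrite big_nat [X in eqm _ _ X]big_nat; apply: eqm_prod => k /andP[k0 _].
  by apply: eqmM; [apply: eqmM|] => //; apply: geom_n.
rewrite big_nat; apply: eqm_prod1 => k /andP[nk _].
have k0 := leq_trans (ltn0Sn n) nk.
have g1 w : eqm n.+1 (geom N k w) 1.
  exact: eqm_trans (geom_n _ _ _ k0 nN) (geom_1 _ _ nk).
rewrite -[X in eqm _ _ X]mulr1; apply: eqmM => //.
by rewrite -[X in eqm _ _ X]mulr1; apply: eqmM => //; apply: small.
Qed.

(* The defining identity of the generating function, with the denominators
   cleared, modulo q^(N+1). *)
Lemma crank_gf N i z : (i <= N)%N ->
  ((\poly_(n < N.+1) crank n z) *
    \prod_(1 <= k < N.+1) ((1 - z *: 'X^k) * (1 - z^-1 *: 'X^k)))`_i =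
  (\prod_(1 <= k < N.+1) (1 - 'X^k) : {poly F})`_i.
Proof.
move=> iN; rewrite -(eqm_coef (crank_prod_den N z)) ?ltnS //.
rewrite !coefM; apply: eq_bigr => j _; congr (_ * _).
have jN : (j <= N)%N by apply: leq_trans iN; rewrite -ltnS.
by rewrite coef_poly ltnS jN /crank (crank_prod_stable _ jN).
Qed.

End Facts.

Lemma Phi_zeta_neq0 l m : (0 < l)%N -> Phi l (zeta ^+ m) != 0.
Proof.
move=> l0; pose p : {poly int} := \sum_(i < l) 'X^(m * i).
have -> : Phi l (zeta ^+ m) = FracField.tofrac p.
  rewrite /Phi /p rmorph_sum; apply: eq_bigr => i _.
  by rewrite -exprM -rmorphXn.
rewrite tofrac_eq0; apply/eqP => /(congr1 (horner^~ 1)).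
rewrite horner_sum horner0 (eq_bigr (fun=> 1)) => [|i _].
  by rewrite sumr_const card_ord => /eqP; rewrite Num.Theory.pnatr_eq0 (gtn_eqF l0).
by rewrite hornerXn expr1n.
Qed.

(* Main.v *)
Require Import Defs.
From mathcomp Require Import all_boot all_order all_algebra all_field.
From mathcomp Require Import qpoly.
From mathcomp Require Import zify ring.

(* Two applications of the q-binomial theorem expand the generating function as
   a double sum of (1 - q) z^(k - n) q^(n + k + nk) / ((q)_n (q)_k), which gives
   M(m, N) as a single sum over n; telescoping turns M(m) - M(m + 1) and
   M(m) - M(m + 2) into sums whose terms are visibly non-negative up to finitely
   many powers of q.  The negative differences that matter are repaired by the
   modification of the crank, except for l = 5, N = 9 and m = 2, where the
   difference at m = 7 compensates.

   Divisibility means that crank_N vanishes at the roots z of Phi_l(z^s).  There,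
   multiplying the generating function by a power series in q^l turns it into a
   product of two Jacobi theta series (l = 5, 7) or into Winquist's product of
   four of them (l = 11), hence into a double sum over pairs of odd integers x, y
   whose exponent of q lies in the residue class of N modulo l only if a quadratic
   form x^2 + y^2 or x^2 + 2 y^2, anisotropic modulo l, vanishes at (x, y).  Then
   l divides y, and the terms for y and - y cancel.

   Finally, if (z^s - 1) p = g (z^(s l) - 1) with p symmetric, the coefficients of
   g satisfy g_i = g_(i - s l) + p_i - p_(i - s), so the low ones are sums of
   differences of counts, and by symmetry so are the high ones. *)

Set Implicit Arguments.
Unset Strict Implicit.
Unset Printing Implicit Defensive.

Import Order.TTheory GRing.Theory Num.Theory.
Local Open Scope ring_scope.

(** * The expansion of the crank generating function *)

(** Working in a ring where q^(N + 1) = 0 makes all products and series finite and their identities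
    exact; only the coefficient of q^N is read off at the end. The obstacle to positivity is the
    numerator: in each term of a difference of neighbouring rows, two factors 1 - q and one further
    factor face the two q-factorials of [rect]. For n >= 1 they cancel, except in row 2, but for n =
    0 one q-factorial is empty and a term - q survives. It reflects that M(N, N) = 1 while M(N - 1,
    N) = 0 for N >= 2. The modified crank moves this unit from the exponents N and - N to N - l and
    l - N, which changes no value where z^l = 1. The price is that the difference at m = N - l - 1
    drops by 1. So few exceptions are not enough: row m must have a positive coefficient at N = m +
    6, m + 8 or m + 12, for l = 5, 7 or 11, whenever that N is in the right class modulo l. Small
    rows, where this is delicate, are settled one by one. *)

(* When q^(N + 1) = 0, iv k is the inverse of 1 - q^k, iqf n is 1 / (q; q)_n and
   qprod z is the infinite product (z q; q). *)
Definition iv (A : comNzRingType) (N : nat) (q : A) (k : nat) : A :=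
  \sum_(j < N.+1) q ^+ (k * j).

Definition iqf (A : comNzRingType) (N : nat) (q : A) (n : nat) : A :=
  \prod_(i < n) iv N q i.+1.

Definition rect (A : comNzRingType) (N : nat) (q : A) (n k : nat) : A :=
  q ^+ (n + k + n * k) * iqf N q n * iqf N q k.

Definition qprod (A : comNzRingType) (N : nat) (q z : A) : A :=
  \prod_(i < N) (1 - z * q ^+ i.+1).

Lemma mul_inv_inj (A : comNzRingType) (u v x y : A) :
  u * v = 1 -> u * x = u * y -> x = y.
Proof.
move=> uv /(congr1 ( *%R v)).
by rewrite !mulrA [v * u]mulrC uv !mul1r.
Qed.

Section Nilpotent.
Variables (A : comNzRingType) (N : nat) (q : A).
Hypothesis qN : q ^+ N.+1 = 0.

Lemma expr_nil e : (N < e)%N -> q ^+ e = 0.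
Proof. by move=> Ne; rewrite -(subnKC Ne) exprD qN mul0r. Qed.

Lemma mulr_iv k : (0 < k)%N -> (1 - q ^+ k) * iv N q k = 1.
Proof.
move=> k0; have := subrXX 1 (q ^+ k) N.+1.
rewrite expr1n -exprM (@expr_nil (k * N.+1)) ?leq_pmull // subr0 => h; rewrite [RHS]h; congr (_ *
  _).
by apply: eq_bigr => j _; rewrite expr1n mul1r exprM.
Qed.

Lemma iqf0 : iqf N q 0 = 1.
Proof. by rewrite /iqf big_ord0. Qed.

Lemma iqfS n : iqf N q n.+1 = iqf N q n * iv N q n.+1.
Proof. by rewrite /iqf big_ord_recr. Qed.

Lemma iqfE n : iqf N q n = \prod_(k <- iota 1 n) iv N q k.
Proof.
rewrite /iqf -(big_mkord xpredT (fun i => iv N q i.+1)) /index_iota subn0.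
by rewrite (iotaDl 1 0) big_map.
Qed.

Lemma iqfSK n : (1 - q ^+ n.+1) * iqf N q n.+1 = iqf N q n.
Proof. by rewrite iqfS mulrCA mulr_iv // mulr1. Qed.

Lemma qprod_shift z n :
  qprod N q z = (\prod_(i < n) (1 - z * q ^+ i.+1)) * qprod N q (z * q ^+ n).
Proof.
have -> : qprod N q z = \prod_(i < N + n) (1 - z * q ^+ i.+1).
  rewrite big_split_ord /= -[LHS]mulr1; congr (_ * _).
  by rewrite big1 // => i _; rewrite expr_nil ?mulr0 ?subr0 // ltnS leq_addr.
rewrite addnC big_split_ord /=; congr (_ * _); apply: eq_bigr => i _.
by rewrite -mulrA -exprD addnS.
Qed.

(* The q-binomial series of (a x; q) / (x; q). *)
Let qb a x : A :=
  \sum_(n < N.+1) x ^+ n * (\prod_(i < n) (1 - a * q ^+ i)) * iqf N q n.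

(** [iqfSK] lowers the index in the difference of the two series, and the top term that is left over
    carries x^(N + 1) = 0. *)
Lemma qbinom_step a x : x ^+ N.+1 = 0 ->
  (1 - x) * qb a x = (1 - a * x) * qb a (x * q).
Proof.
move=> xN; suff h : qb a x - qb a (x * q) = x * (qb a x - a * qb a (x * q)).
  apply/eqP; rewrite -subr_eq0; apply/eqP; transitivity
    (qb a x - qb a (x * q) - x * (qb a x - a * qb a (x * q))); first by ring.
  by rewrite h subrr.
pose P n := \prod_(i < n) (1 - a * q ^+ i).
rewrite /qb -sumrB big_ord_recl /= !expr0 subrr add0r.
rewrite mulr_sumr -sumrB mulr_sumr [RHS]big_ord_recr /=.
have -> : x * (x ^+ N * P N * iqf N q N - a * ((x * q) ^+ N * P N * iqf N q N)) = 0.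
  transitivity (x ^+ N.+1 * (P N * iqf N q N - a * q ^+ N * P N * iqf N q N)).
    by rewrite exprMn exprS; ring.
  by rewrite xN mul0r.
rewrite addr0; apply: eq_bigr => i _; rewrite /bump /= add1n.
rewrite big_ord_recr /= -(iqfSK i) !exprMn exprS [q ^+ i.+1]exprS.
by ring.
Qed.

(** Iterating the functional equation N times replaces y q by y q^(N + 1) = 0, where the series is
    1. The argument y q, rather than y, is nilpotent even when y is a unit. *)
Lemma qbinom a y :
  qprod N q y * qb a (y * q) = qprod N q (a * y).
Proof.
have nil K : (y * q ^+ K.+1) ^+ N.+1 = 0.
  by rewrite exprMn -exprM expr_nil ?mulr0 // mulSn leq_addr.
have iter K : \prod_(i < K) (1 - y * q ^+ i.+1) * qb a (y * q) =
    \prod_(i < K) (1 - a * y * q ^+ i.+1) * qb a (y * q ^+ K.+1).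
  elim: K => [|K IH]; first by rewrite !big_ord0 expr1.
  rewrite !big_ord_recr /= -mulrA [(1 - _) * qb _ _]mulrC mulrA IH -!mulrA.
  congr (_ * _); rewrite mulrC qbinom_step // mulrA.
  by rewrite -[y * _ * q]mulrA -exprSr.
rewrite /qprod iter expr_nil // mulr0 -[RHS]mulr1; congr (_ * _).
rewrite /qb big_ord_recl /= big_ord0 iqf0 expr0 !mul1r big1 ?addr0 // => i _.
by rewrite exprS !mul0r.
Qed.

(** The sum over k is Euler's case a = 0 and leaves (z q; q)_n, the numerator of the q-binomial
    series with a = z q at w q. Since z w = 1, the product side of the latter is (q^2; q), which the
    factor 1 - q completes. *)
Lemma crank_expansion z w : z * w = 1 ->
  (\sum_(n < N.+1) \sum_(k < N.+1) z ^+ k * w ^+ n * ((1 - q) * rect N q n k))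
    * (qprod N q z * qprod N q w) = qprod N q 1.
Proof.
move=> zw.
have inner n : qprod N q z * \sum_(k < N.+1) (z * q ^+ n.+1) ^+ k * iqf N q k =
    \prod_(i < n) (1 - z * q * q ^+ i).
  rewrite (qprod_shift z n) -[RHS]mulr1 -mulrA; congr (_ * _).
    by apply: eq_bigr => i _; rewrite exprS mulrA.
  have := qbinom 0 (z * q ^+ n); rewrite mul0r /qb => h.
  rewrite -[RHS](_ : qprod N q 0 = 1); last first.
    by rewrite /qprod big1 // => i _; rewrite mul0r subr0.
  rewrite -h; congr (_ * _); apply: eq_bigr => k _.
  by rewrite big1 ?mulr1 -?mulrA -?exprSr // => i _; rewrite mul0r subr0.
have -> : \sum_(n < N.+1) \sum_(k < N.+1) z ^+ k * w ^+ n * ((1 - q) * rect N q n k)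
  = (1 - q) * \sum_(n < N.+1) (w * q) ^+ n * iqf N q n *
      \sum_(k < N.+1) (z * q ^+ n.+1) ^+ k * iqf N q k.
  rewrite mulr_sumr; apply: eq_bigr => n _; rewrite !mulr_sumr.
  apply: eq_bigr => k _; rewrite /rect !exprMn -exprM mulSn -addnA !exprD.
  by rewrite [(n * k)%N]mulnC; ring.
transitivity ((1 - q) * (qprod N q w * qb (z * q) (w * q))).
  rewrite -mulrA [X in _ * X](_ : _ = qprod N q w * (qprod N q z * \sum_(n < N.+1)
    (w * q) ^+ n * iqf N q n *
      \sum_(k < N.+1) (z * q ^+ n.+1) ^+ k * iqf N q k)); last by ring.
  congr (_ * (_ * _)); rewrite mulr_sumr; apply: eq_bigr => n _.
  by rewrite mulrCA inner; ring.
rewrite qbinom mulrAC zw mul1r.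
have -> : qprod N q 1 = \prod_(i < N.+1) (1 - 1 * q ^+ i.+1).
  by rewrite big_ord_recr /= qN mulr0 subr0 mulr1.
rewrite big_ord_recl /= mul1r; congr (_ * _); apply: eq_bigr => i _.
by rewrite mul1r -exprS.
Qed.

End Nilpotent.

(* The generating function of M(m, n) over n. *)
Definition crank_row (A : comNzRingType) (N : nat) (q : A) (m : nat) : A :=
  \sum_(n < N.+1) (1 - q) * rect N q n (n + m).

Section CrankDifferences.
Variables (A : comNzRingType) (N : nat) (q : A).
Hypothesis qN : q ^+ N.+1 = 0.

Lemma sum_telescope (c F G : nat -> A) :
  (forall n, F n - G n = c n - c n.+1) -> c 0%N = 0 -> c N.+1 = 0 ->
  \sum_(n < N.+1) F n = \sum_(n < N.+1) G n.
Proof.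
move=> h c0 cN; apply/eqP; rewrite -subr_eq0 -sumrB; under eq_bigr do rewrite h.
suff -> K : \sum_(n < K) (c n - c n.+1) = c 0%N - c K by rewrite c0 cN subrr.
elim: K => [|K IH]; first by rewrite big_ord0 subrr.
by rewrite big_ord_recr IH /=; ring.
Qed.

(** Subtracting the rows term by term gives summands of no evident sign; the differences of [c]
    shift parts between consecutive n until each summand is a product of factors that the
    q-factorials can cancel. *)
Lemma crank_diff1 m :
  crank_row N q m.+1 - crank_row N q m.+2 =
  \sum_(n < N.+1) (1 - q) ^+ 2 * rect N q n (n + m.+1) * q ^+ n *
     ((1 - q ^+ m) + (1 - q ^+ 3) * q ^+ (m + n)).
Proof.
pose U n : A := q ^+ (n + (n + m) + n * (n + m.+1)) * iqf N q n * iqf N q (n + m.+1).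
pose X n : A := q ^+ n; pose Y n : A := q ^+ (n + m.+1).
have US n : U n.+1 * (1 - q ^+ n.+1) = U n * q ^+ 3 * X n * Y n * iv N q (n + m.+2).
  rewrite /U [LHS](_ : _ = q ^+ (n.+1 + (n.+1 + m) + n.+1 * (n.+1 + m.+1)) *
    ((1 - q ^+ n.+1) * iqf N q n.+1) * iqf N q (n.+1 + m.+1)); last by ring.
  rewrite iqfSK // (_ : (n.+1 + (n.+1 + m) + n.+1 * (n.+1 + m.+1) =
    3 + n + (n + m.+1) + (n + (n + m) + n * (n + m.+1)))%N); last by nia.
  rewrite [(n.+1 + m.+1)%N]addSn iqfS [(n + m.+2)%N]addnS.
  rewrite !exprD /X /Y !exprD; ring.
have cS n : U n.+1 * (1 - q ^+ n.+1) * (1 - q ^+ (n + m.+2)) = U n * q ^+ 3 * X n * Y n.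
  rewrite US -mulrA [iv _ _ _ * _]mulrC mulr_iv ?mulr1 //.
  by rewrite addnS.
have iE n : iv N q (n + m.+2) = 1 + q * Y n * iv N q (n + m.+2).
  have := @mulr_iv A N q qN (n + m.+2); rewrite addnS => /(_ isT) h.
  by rewrite -[X in _ = X + _]h /Y exprS; ring.
have R0 n : rect N q n (n + m.+1) = q * U n.
  rewrite /rect /U.
  have -> : (n + (n + m.+1) + n * (n + m.+1) =
    (n + (n + m) + n * (n + m.+1)).+1)%N by lia.
  by rewrite exprS; ring.
have R1 n : rect N q n (n + m.+2) = U n * q ^+ 2 * X n * (1 + q * Y n * iv N q (n + m.+2)).
  rewrite -iE /rect /U /X (_ : (n + (n + m.+2) + n * (n + m.+2) =
    2 + n + (n + (n + m) + n * (n + m.+1)))%N); last by nia.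
  rewrite [(n + m.+2)%N]addnS iqfS.
  by rewrite !exprD; ring.
(* Both ends vanish: [1 - X n] is 0 at n = 0, and the power of q in [U] exceeds N at n = N + 1. *)
pose c n := (1 - q) * (U n * (1 - X n) - (1 - q) * (U n * (1 - X n) * (1 - Y n))).
rewrite /crank_row -sumrB.
apply: (@sum_telescope c (fun n => (1 - q) * rect N q n (n + m.+1) - (1 - q) * rect N q n (n +
  m.+2)) (fun n => (1 - q) ^+ 2 * rect N q n (n + m.+1) * q ^+ n *
     ((1 - q ^+ m) + (1 - q ^+ 3) * q ^+ (m + n)))) => [n||].
- have -> : c n.+1 = (1 - q) * (U n * q ^+ 3 * X n * Y n * iv N q (n + m.+2)
     - (1 - q) * (U n * q ^+ 3 * X n * Y n)).
    by rewrite /c -US -cS /X /Y addSnnS.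
  rewrite /c R0 R1; have -> : q ^+ n = X n by [].
  have -> : Y n = q * q ^+ m * X n by rewrite /Y /X !exprD exprS; ring.
  rewrite exprD; have -> : q ^+ n = X n by [].
  by ring.
- by rewrite /c /X expr0 subrr mulr0 !mul0r !mulr0 subr0 mulr0.
- rewrite /c /U (expr_nil qN) ?mul0r ?mulr0 ?subr0 ?mulr0 //; nia.
Qed.

Lemma crank_diff2 m :
  crank_row N q m - crank_row N q m.+2 =
  \sum_(n < N.+1) (1 - q) * (1 - q ^+ 2) * (1 - q ^+ m.+1) *
     rect N q n (n + m) * q ^+ (2 * n) * iv N q (n + m).+1.
Proof.
pose P n := rect N q n (n + m).
pose X n : A := q ^+ n; pose Y n : A := q ^+ (n + m).
have PS n : P n.+1 * (1 - q ^+ n.+1) = P n * q ^+ 3 * X n * Y n * iv N q (n + m).+1.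
  rewrite /P /rect [LHS](_ : _ = q ^+ (n.+1 + (n.+1 + m) + n.+1 * (n.+1 + m)) *
    ((1 - q ^+ n.+1) * iqf N q n.+1) * iqf N q (n.+1 + m)); last by ring.
  rewrite iqfSK // (_ : (n.+1 + (n.+1 + m) + n.+1 * (n.+1 + m) =
    3 + n + (n + m) + (n + (n + m) + n * (n + m)))%N); last by nia.
  rewrite [(n.+1 + m)%N]addSn iqfS.
  rewrite !exprD /X /Y !exprD; ring.
have R2 n : rect N q n (n + m.+2) = P n * q ^+ 2 * X n ^+ 2 * iv N q (n + m).+1 * iv N q (n + m).+2.
  rewrite /P /rect /X (_ : (n + (n + m.+2) + n * (n + m.+2) =
    2 + n + n + (n + (n + m) + n * (n + m)))%N); last by nia.
  rewrite !addnS !iqfS.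
  by rewrite !exprD; ring.
pose c n := (1 - q) * (P n * (1 - X n) * (1 + X n - q * Y n) * iv N q (n + m).+1).
rewrite /crank_row -sumrB.
apply: (@sum_telescope c (fun n => (1 - q) * rect N q n (n + m) - (1 - q) * rect N q n (n +
  m.+2)) (fun n => (1 - q) * (1 - q ^+ 2) * (1 - q ^+ m.+1) *
     rect N q n (n + m) * q ^+ (2 * n) * iv N q (n + m).+1)) => [n||].
- have -> : c n.+1 = (1 - q) * (P n * q ^+ 3 * X n * Y n * iv N q (n + m).+1 *
     (1 + q * X n - q ^+ 2 * Y n) * iv N q (n + m).+2).
    by rewrite /c -PS /X /Y !addSn !exprS; ring.
  rewrite R2 /c mul2n -addnn exprD [q ^+ m.+1]exprS.
  have -> : rect N q n (n + m) = P n by [].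
  have -> : q ^+ n = X n by [].
  have YE : Y n = q ^+ m * X n by rewrite /Y /X exprD; ring.
  have h1 := @mulr_iv A N q qN (n + m).+1 isT.
  have h2 := @mulr_iv A N q qN (n + m).+2 isT.
  have E1 : q ^+ (n + m).+1 = q * Y n by rewrite exprS.
  have E2 : q ^+ (n + m).+2 = q ^+ 2 * Y n by rewrite -(add2n (n + m)) exprD.
  move: h1 h2; rewrite E1 E2 YE.
  set i := iv _ _ _; set j := iv _ _ _; set x := X n; set M := q ^+ m.
  (* Multiplying by both denominators leaves a polynomial identity. *)
  move=> h1 h2; apply: (mul_inv_inj h2); apply: (mul_inv_inj h1).
  transitivity ((1 - q) * P n * (((1 - q * (M * x)) * ((1 - q ^+ 2 * (M * x)))) -
     q ^+ 2 * x ^+ 2 * ((1 - q * (M * x)) * i) * ((1 - q ^+ 2 * (M * x)) * j) -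
     (1 - q ^+ 2) * (1 - q * M) * (x * x) *  ((1 - q * (M * x)) * i) * (1 - q ^+ 2 * (M * x))));
       first by ring.
  transitivity ((1 - q) * P n * ((1 - x) * (1 + x - q * (M * x)) * ((1 - q * (M * x)) * i) * (1 -
    q ^+ 2 * (M * x)) - q ^+ 3 * x * (M * x) * ((1 - q * (M * x)) * i) * ((1 - q ^+ 2 * (M *
    x)) * j) * (1 + q * x - q ^+ 2 * (M * x)))); last by ring.
  by rewrite h1 h2; ring.
- by rewrite /c /X expr0 subrr !mulr0 !mul0r mulr0.
- rewrite /c /P /rect (expr_nil qN) ?mul0r ?mulr0 //; nia.
Qed.

End CrankDifferences.

(** * Lower bounds for differences of crank counts *)

(** The subsemiring generated by q replaces non-negativity of coefficients in a ring that carries no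
    order; [nonneg_coef] translates back. *)
Inductive nonneg (A : comNzRingType) (q : A) : A -> Prop :=
| nonneg0 : nonneg q 0
| nonneg1 : nonneg q 1
| nonnegX : nonneg q q
| nonnegD x y : nonneg q x -> nonneg q y -> nonneg q (x + y)
| nonnegM x y : nonneg q x -> nonneg q y -> nonneg q (x * y).

Fixpoint submultiset (s t : seq nat) : bool :=
  if s is k :: s' then (k \in t) && submultiset s' (rem k t) else true.

(** Monomials times products of factors 1 - q^k, each of which a denominator cancels: a numerator
    written in this form has a non-negative quotient. *)
Definition certificate (A : comNzRingType) (q : A) (L : seq (nat * seq nat)) : A :=
  \sum_(c <- L) q ^+ c.1 * \prod_(k <- c.2) (1 - q ^+ k).

Section Nonneg.
Variables (A : comNzRingType) (N : nat) (q : A).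
Hypothesis qN : q ^+ N.+1 = 0.
Local Notation v k := (iv N q k).
Local Notation iqf := (iqf N q).
Local Notation nn := (nonneg q).

Lemma nonnegXn e : nn (q ^+ e).
Proof. by elim: e => [|e IH]; [exact: nonneg1 | rewrite exprS; exact: nonnegM (nonnegX q) IH]. Qed.

Lemma nonneg_sum I (r : seq I) (P : pred I) (F : I -> A) :
  (forall i, P i -> nn (F i)) -> nn (\sum_(i <- r | P i) F i).
Proof.
by move=> h; elim/big_rec: _ => [|i x Pi nx]; [exact: nonneg0 | exact: nonnegD (h i Pi) nx].
Qed.

Lemma nonneg_prod I (r : seq I) (P : pred I) (F : I -> A) :
  (forall i, P i -> nn (F i)) -> nn (\prod_(i <- r | P i) F i).
Proof.
by move=> h; elim/big_rec: _ => [|i x Pi nx]; [exact: nonneg1 | exact: nonnegM (h i Pi) nx].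
Qed.

Lemma nonneg_iv k : nn (v k).
Proof. by apply: nonneg_sum => i _; apply: nonnegXn. Qed.

Lemma nonneg_iqf n : nn (iqf n).
Proof. by apply: nonneg_prod => i _; apply: nonneg_iv. Qed.

Lemma nonneg_cancel s t : all (leq 1) t -> submultiset s t ->
  nn (\prod_(k <- s) (1 - q ^+ k) * \prod_(k <- t) v k).
Proof.
elim: s t => [|k s IH] t t0 /=.
  by rewrite big_nil mul1r => _; apply: nonneg_prod => i _; apply: nonneg_iv.
case/andP=> kt st; rewrite big_cons (perm_big _ (perm_to_rem kt)) big_cons /=.
rewrite mulrACA mulr_iv ?mul1r //; last exact: (allP t0).
by apply: IH => //; apply/allP => j /mem_rem /(allP t0).
Qed.

Lemma nonneg_certificate L t : all (leq 1) t ->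
  all (fun c => submultiset c.2 t) L ->
  nn (certificate q L * \prod_(k <- t) v k).
Proof.
move=> t0 /allP hL; rewrite /certificate big_seq mulr_suml.
apply: nonneg_sum => c /hL hc; rewrite -mulrA.
by apply: nonnegM; [exact: nonnegXn | exact: nonneg_cancel].
Qed.

Lemma nonneg_iqf_cancel s n : uniq s -> all (fun k => 0 < k <= n)%N s ->
  nn (\prod_(k <- s) (1 - q ^+ k) * iqf n).
Proof.
move=> us /allP sn; rewrite iqfE; apply: nonneg_cancel.
  by apply/allP => k; rewrite mem_iota => /andP[].
have {sn}: {subset s <= iota 1 n} by move=> k /sn; rewrite mem_iota add1n ltnS.
have := iota_uniq 1 n; elim: s us (iota 1 n) => //= k s IH /andP[ks us] t ut st.
rewrite st ?mem_head //=; apply: IH => // [|j js]; first exact: rem_uniq.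
rewrite mem_rem_uniq // inE st ?inE ?js ?orbT ?andbT //.
by apply: contraNneq ks => <-.
Qed.

Lemma ivE k : (0 < k)%N -> v k = 1 + q ^+ k * v k.
Proof.
move=> k0; apply/eqP; rewrite -subr_eq; apply/eqP.
by rewrite -[RHS](mulr_iv qN k0); ring.
Qed.

Lemma iv_ge1 k : nn (v k - 1).
Proof.
rewrite /iv big_ord_recl muln0 expr0 addrAC subrr add0r.
by apply: nonneg_sum => j _; apply: nonnegXn.
Qed.

End Nonneg.

Ltac nonneg_tac :=
  intros; repeat first [assumption | exact: nonneg1 | exact: nonnegX | exact: nonnegXn
    | exact: nonneg_iv | exact: nonneg_iqf | exact: iv_ge1
    | apply: nonnegD | apply: nonnegM].

Ltac certificate_ring := rewrite /certificate /= !big_cons !big_nil /=; ring.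

(* The terms of crank_diff1. *)
Definition diff_term (A : comNzRingType) (N : nat) (q : A) (m n : nat) : A :=
  (1 - q) ^+ 2 * rect N q n (n + m.+1) * q ^+ n *
    ((1 - q ^+ m) + (1 - q ^+ 3) * q ^+ (m + n)).

Section DifferenceTerms.
Variables (A : comNzRingType) (N : nat) (q : A).
Hypothesis qN : q ^+ N.+1 = 0.
Local Notation i k := (iv N q k).
Local Notation iqf := (iqf N q).
Local Notation nn := (nonneg q).
Local Notation D m := (crank_row N q m - crank_row N q m.+1).
Local Notation t := (diff_term N q).

Lemma nonneg_add x y : nn (x - y) -> nn y -> nn x.
Proof. by move=> h /(nonnegD h); rewrite subrK. Qed.

Lemma diff_term0 m :
  t m 0 = q ^+ m.+1 * (1 - q) ^+ 2 * (1 - q ^+ (m + 3)) * iqf m.+1.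
Proof. by rewrite /diff_term /rect iqf0 mul0n addn0 !add0n addn0 exprD; ring. Qed.

Lemma diff_term1 m : t m 1 = (1 - q) * q ^+ (2 * m + 6) * iqf m.+2 *
  ((1 - q ^+ m) + (1 - q ^+ 3) * q ^+ m.+1).
Proof.
have iq1 : iqf 1 = i 1 by rewrite iqfS iqf0 mul1r.
rewrite /diff_term /rect iq1 mul1n (_ : (1 + (1 + m.+1) + (1 + m.+1) = 2 * m + 5)%N); last by lia.
rewrite (_ : (2 * m + 6 = (2 * m + 5).+1)%N); last by lia.
rewrite addn1 expr1 [q ^+ (2 * m + 5).+1]exprS add1n.
have h := @mulr_iv A N q qN 1 isT; rewrite expr1 in h.
transitivity ((1 - q) * ((1 - q) * i 1) * q ^+ (2 * m + 5) * iqf m.+2 * q *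
  ((1 - q ^+ m) + (1 - q ^+ 3) * q ^+ m.+1)); first by ring.
by rewrite h; ring.
Qed.

Lemma diff_term_nil m n : (N < n)%N -> t m n = 0.
Proof. by move=> Nn; rewrite /diff_term (expr_nil qN Nn) mulr0 mul0r. Qed.

Lemma diff_sum m K :
  D m.+1 = \sum_(n < K) t m n + \sum_(n < N.+1) t m (n + K).
Proof.
rewrite (crank_diff1 qN).
transitivity (\sum_(n < N.+1 + K) t m n).
  rewrite big_split_ord /= [X in _ = _ + X]big1 ?addr0 // => n _.
  by rewrite diff_term_nil // ltnS leq_addr.
rewrite addnC big_split_ord /=; congr (_ + _).
by apply: eq_bigr => n _; rewrite addnC.
Qed.

(** One factor 1 - q cancels in [iqf n], the other together with 1 - q^m or 1 - q^3 in
    [iqf (n + m.+1)]. This takes m different from 1, so row 2 is treated apart. *)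
Lemma diff_term_nonneg m n : (1 < m)%N -> (0 < n)%N -> nn (t m n).
Proof.
move=> m1 n0.
have h1 : nn (iqf n * (1 - q)).
  have a1 : all (fun k => 0 < k <= n)%N [:: 1%N] by rewrite /= n0.
  by have := nonneg_iqf_cancel qN (isT : uniq [:: 1%N]) a1; rewrite big_seq1 expr1 mulrC.
have h2 k : (1 < k <= n + m.+1)%N -> nn (iqf (n + m.+1) * ((1 - q) * (1 - q ^+ k))).
  move=> hk; have u : uniq [:: 1%N; k] by rewrite /= inE; lia.
  have a : all (fun k => 0 < k <= n + m.+1)%N [:: 1%N; k] by rewrite /=; lia.
  by have := nonneg_iqf_cancel qN u a; rewrite !big_cons big_nil mulr1 expr1 mulrC.
have {}h3 := h2 3; have {}h2 := h2 m.
have {h2}/h2 h2 : (1 < m <= n + m.+1)%N by lia.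
have {h3}/h3 h3 : (1 < 3 <= n + m.+1)%N by lia.
rewrite /diff_term /rect.
set e := q ^+ (_ + _)%N; set u := iqf n in h1 *; set v := iqf _ in h2 h3 *.
rewrite [X in nn X](_ : _ = e * q ^+ n * (u * (1 - q)) * (v * ((1 - q) * (1 - q ^+ m)) +
  v * ((1 - q) * (1 - q ^+ 3)) * q ^+ (m + n))); last by ring.
by nonneg_tac.
Qed.

Lemma diff_tail m : (1 < m)%N -> nn (D m.+1 - (t m 0 + t m 1)).
Proof.
move=> m1; rewrite (diff_sum m 2).
have -> : \sum_(n < 2) t m n = t m 0 + t m 1 by rewrite !big_ord_recr big_ord0 /= add0r.
rewrite addrC addKr.
by apply: nonneg_sum => n _; apply: diff_term_nonneg => //; rewrite addn2.
Qed.

End DifferenceTerms.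

(** * Differences of neighbouring rows from row 8 on *)

Section LargeRows.
Variables (A : comNzRingType) (N : nat) (q : A).
Hypothesis qN : q ^+ N.+1 = 0.
Local Notation i k := (iv N q k).
Local Notation iqf := (iqf N q).
Local Notation nn := (nonneg q).
Local Notation D m := (crank_row N q m - crank_row N q m.+1).
Local Notation t := (diff_term N q).

Let h k : (1 - q ^+ k.+1) * i k.+1 = 1 := mulr_iv qN (ltn0Sn k).

Lemma iv_ge2 k : (0 < k)%N -> nn (i k - 1 - q ^+ k).
Proof.
move=> k0; rewrite [X in nn X](_ : _ = q ^+ k * (i k - 1)); first by nonneg_tac.
by rewrite {1}(ivE qN k0); ring.
Qed.

Lemma nonneg_le x y : nn (y - x) -> nn x -> nn y.
Proof. by move=> hy hx; apply: nonneg_add hy hx. Qed.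

(* Dividing -q by 1 - q^k produces the extra term - q^(k + 1) / (1 - q^k), which
   the term q^(k + 1) of B absorbs. *)
Lemma quot_step B R k : (0 < k)%N ->
  nn (B + q - R - q ^+ k.+1) -> nn (B * i k + q - R * i k).
Proof.
move=> k0 hB; rewrite [X in nn X](_ : _ = (B + q - R - q ^+ k.+1) * i k); first by nonneg_tac.
have E : B * i k + q * ((1 - q ^+ k) * i k) - R * i k = (B + q - R - q ^+ k.+1) * i k.
  by rewrite exprS; ring.
by rewrite (mulr_iv qN k0) mulr1 in E.
Qed.

(** What remains of (1 - q) / ((1 - q^2) ... (1 - q^5)) once its only negative term - q is split
    off. [Y] plays the same role for the product that starts at 1 - q^3. *)
Let X : A := i 4 + q ^+ 10 * i 4 * i 5 + q ^+ 2 * i 4 * i 6 + q ^+ 12 * i 4 * i 5 * i 6.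

Lemma iv23 : (1 - q) * i 2 * i 3 = (1 - q + q ^+ 2) * i 6.
Proof.
have E : (1 - q) * i 2 * i 3 * ((1 - q ^+ 6) * i 6) =
  (1 - q + q ^+ 2) * ((1 - q ^+ 2) * i 2) * ((1 - q ^+ 3) * i 3) * i 6 by ring.
by rewrite !h !mulr1 in E.
Qed.

Lemma quot25 : (1 - q) * i 2 * i 3 * i 4 * i 5 = X - q.
Proof.
rewrite iv23 /X.
have E : (1 - q + q ^+ 2) * i 6 * i 4 * i 5 =
  i 4 * ((1 - q ^+ 5) * i 5) * ((1 - q ^+ 6) * i 6) +
  q ^+ 10 * i 4 * i 5 * ((1 - q ^+ 6) * i 6) +
  q ^+ 2 * i 4 * i 6 * ((1 - q ^+ 5) * i 5) + q ^+ 12 * i 4 * i 5 * i 6 -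
  q * ((1 - q ^+ 4) * i 4) * ((1 - q ^+ 5) * i 5) * ((1 - q ^+ 6) * i 6) by ring.
by rewrite !h !mulr1 in E.
Qed.

Let Y : A := (1 + q ^+ 3 + q ^+ 8) * i 12 + q ^+ 18 * i 5 * i 12.

Lemma quot35 : (1 - q) * i 3 * i 4 * i 5 = Y - q.
Proof.
(* The polynomial (1 - q) (1 - q^12) / ((1 - q^3) (1 - q^4)) is the product of the sixth and twelfth
   cyclotomic polynomials. *)
have E : (1 - q) * i 3 * i 4 * i 5 * ((1 - q ^+ 12) * i 12) =
  (1 - q + q ^+ 3 - q ^+ 5 + q ^+ 6) * ((1 - q ^+ 3) * i 3) * ((1 - q ^+ 4) * i 4) * i 5 *
    i 12 by ring.
rewrite !h !mulr1 in E; rewrite E /Y.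
have {}E : (1 - q + q ^+ 3 - q ^+ 5 + q ^+ 6) * i 5 * i 12 =
  (1 + q ^+ 3 + q ^+ 8) * i 12 * ((1 - q ^+ 5) * i 5) + q ^+ 18 * i 5 * i 12
  - q * ((1 - q ^+ 5) * i 5) * ((1 - q ^+ 12) * i 12) by ring.
by rewrite !h !mulr1 in E.
Qed.

Lemma nonneg_X : nn (X - 1 - q ^+ 2 - q ^+ 4 - q ^+ 8).
Proof.
rewrite /X [X in nn X](_ : _ = q ^+ 4 * (i 4 - 1 - q ^+ 4) +
  q ^+ 10 * i 4 * i 5 + q ^+ 2 * (i 4 * (i 6 - 1) + (i 4 - 1)) + q ^+ 12 * i 4 * i 5 * i 6).
  by have := @iv_ge2 4 isT; nonneg_tac.
by rewrite {1}(ivE qN (isT : 0 < 4)%N); ring.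
Qed.

Lemma nonneg_Y : nn (Y - 1 - q ^+ 3 - q ^+ 8).
Proof.
rewrite /Y [X in nn X](_ : _ = (1 + q ^+ 3 + q ^+ 8) * (i 12 - 1) + q ^+ 18 * i 5 * i 12);
  last by ring.
by nonneg_tac.
Qed.

Lemma quot67 Z : (Z - q) * i 6 * i 7 + q =
  (Z - 1 - q ^+ 8) * i 6 * i 7 + i 6 + q ^+ 14 * i 6 * i 7.
Proof.
have E : (Z - q) * i 6 * i 7 + q * ((1 - q ^+ 6) * i 6) * ((1 - q ^+ 7) * i 7) =
  (Z - 1 - q ^+ 8) * i 6 * i 7 + i 6 * ((1 - q ^+ 7) * i 7) + q ^+ 14 * i 6 * i 7 by ring.
by rewrite !h !mulr1 in E.
Qed.

(** The exponents are l + 1 for l = 5, 7, 11: row N - l - 1 has to make up for the unit added at N -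
    l. *)
Let S : A := q ^+ 6 + q ^+ 8 + q ^+ 12.

Lemma nonneg_iv67 : nn (i 6 * i 7 - 1 - q ^+ 6 - q ^+ 7).
Proof.
rewrite [X in nn X](_ : _ = (i 6 - 1) * (i 7 - 1) + (i 6 - 1 - q ^+ 6) + (i 7 - 1 - q ^+ 7));
  last by ring.
by have := @iv_ge2 6 isT; have := @iv_ge2 7 isT; nonneg_tac.
Qed.

Definition quot s r : A := (1 - q) * \prod_(s <= k < r.+1) i k.

Lemma quotS s r : (s <= r.+1)%N -> quot s r.+1 = quot s r * i r.+1.
Proof. by move=> sr; rewrite /quot big_nat_recr //= mulrA. Qed.

(** The term q^(r + 2) keeps the induction going: [quot_step] consumes it in the division by 1 -
    q^(r + 1), and q^2 / (1 - q^(r + 1)) supplies q^(r + 3) for the next step. *)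
Lemma quot2_low r : (7 <= r)%N ->
  nn (quot 2 r + q - (1 + q ^+ 2 + S) - q ^+ r.+2).
Proof.
move=> r7; rewrite -(subnKC r7); elim: (r - 7)%N => [|j IH].
  rewrite addn0 /quot -[index_iota 2 8]/[:: 2; 3; 4; 5; 6; 7]%N.
  rewrite !big_cons big_nil mulr1 !mulrA quot25 quot67 /S.
  rewrite [X in nn X](_ : _ = (X - 1 - q ^+ 2 - q ^+ 4 - q ^+ 8) * i 6 * i 7 +
     q ^+ 4 * i 6 * i 7 + q ^+ 14 * i 6 * i 7 +
     q ^+ 2 * (i 6 * i 7 - 1 - q ^+ 6 - q ^+ 7) + q ^+ 6 * (i 6 - 1 - q ^+ 6)).
    by have := nonneg_X; have := nonneg_iv67; have := @iv_ge2 6 isT; nonneg_tac.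
  by rewrite [X in X + q ^+ 14 * _ * _ - _ - _](_ : _ = (X - 1 - q ^+ 8) * i 6 * i 7 + (1 +
    q ^+ 6 * i 6)); [ring | rewrite -ivE].
rewrite addnS quotS //; set r' := (7 + j)%N in IH *.
apply: nonneg_le (quot_step (ltn0Sn r') IH).
rewrite [X in nn X](_ : _ = (1 + S) * (i r'.+1 - 1) + q ^+ 2 * (i r'.+1 - 1 - q ^+ r'.+1)).
  by rewrite /S; have := @iv_ge2 r'.+1 isT; nonneg_tac.
by rewrite [q ^+ r'.+3]exprS [q ^+ r'.+2]exprS; ring.
Qed.

Lemma quot3_low r : (7 <= r)%N ->
  nn (quot 3 r + q - (1 + q ^+ 3 + q ^+ r.+3) - q ^+ r.+2).
Proof.
move=> r7; rewrite -(subnKC r7); elim: (r - 7)%N => [|j IH].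
  rewrite addn0 /quot -[index_iota 3 8]/[:: 3; 4; 5; 6; 7]%N.
  rewrite !big_cons big_nil mulr1 !mulrA quot35 quot67.
  rewrite [X in nn X](_ : _ = (Y - 1 - q ^+ 3 - q ^+ 8) * i 6 * i 7 + q ^+ 14 * i 6 * i 7 +
     q ^+ 3 * (i 6 * i 7 - 1 - q ^+ 6 - q ^+ 7) + (i 6 - 1)); last by ring.
  by have := nonneg_Y; have := nonneg_iv67; nonneg_tac.
rewrite addnS quotS //; set r' := (7 + j)%N in IH *.
apply: nonneg_le (quot_step (ltn0Sn r') IH).
rewrite [X in nn X](_ : _ = (i r'.+1 - 1) + q ^+ r'.+3 * (i r'.+1 - 1) +
   q ^+ 3 * (i r'.+1 - 1 - q ^+ r'.+1)).
  by have := @iv_ge2 r'.+1 isT; nonneg_tac.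
by rewrite !exprS; ring.
Qed.

Lemma iqf_quot r : (1 - q) ^+ 2 * iqf r.+1 = quot 2 r.+1.
Proof.
have h1 := h 0; rewrite expr1 in h1.
rewrite /quot iqfE // big_cons.
transitivity ((1 - q) * ((1 - q) * i 1) * \prod_(j <- iota 2 r) i j); first by ring.
by rewrite h1 mulr1 /index_iota !subSS subn0.
Qed.

Lemma diff_low m : (7 <= m)%N ->
  nn (D m.+1 - q ^+ m.+1 * (1 - q + q ^+ 2 + S)).
Proof.
move=> m7; have m1 : (1 < m)%N by lia.
apply: nonneg_le (diff_tail qN m1).
have t1 : nn (t m 1) by apply: diff_term_nonneg.
have l2 := quot2_low m7; have l3 := @quot3_low m.+1 (leqW m7).
(* Since 1 - q^(m + 3) = (1 - q^(m + 1)) + q^(m + 1) (1 - q^2), the term n = 0 splits into two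
   parts, each with one denominator cancelled. The surplus q^(m + 2) of the first absorbs the - q of
   the second. *)
have q3 : (1 - q ^+ 2) * quot 2 m.+1 = quot 3 m.+1.
  by rewrite /quot big_ltn ?ltnS 1?ltnW // mulrCA [X in _ * X]mulrA h mul1r.
have q2 : (1 - q ^+ m.+1) * quot 2 m.+1 = quot 2 m.
  by rewrite (@quotS 2 m (ltnW m1)) mulrCA (h m) mulr1.
rewrite [X in nn X](_ : _ = q ^+ m.+1 * (quot 2 m + q - (1 + q ^+ 2 + S) - q ^+ m.+2) +
   q ^+ m.+1 * q ^+ m.+1 * ((quot 3 m.+1 + q - (1 + q ^+ 3 + q ^+ m.+4) - q ^+ m.+3) +
     1 + q ^+ 3 + q ^+ m.+4 + q ^+ m.+3) + t m 1).
  by nonneg_tac.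
have tE : t m 0 = q ^+ m.+1 * (1 - q ^+ (m + 3)) * quot 2 m.+1.
  by rewrite diff_term0 -iqf_quot; ring.
rewrite tE -q3 -q2 addn3 [q ^+ m.+4]exprS [q ^+ m.+3]exprS [q ^+ m.+2]exprS; ring.
Qed.

End LargeRows.

(** * The rows 3 to 7, by explicit certificates *)

Section RowsThreeToSeven.
Variables (A : comNzRingType) (N : nat) (q : A).
Hypothesis qN : q ^+ N.+1 = 0.
Local Notation i k := (iv N q k).
Local Notation iqf := (iqf N q).
Local Notation nn := (nonneg q).
Local Notation D m := (crank_row N q m - crank_row N q m.+1).
Local Notation t := (diff_term N q).

Let h k : (1 - q ^+ k.+1) * i k.+1 = 1 := mulr_iv qN (ltn0Sn k).
Lemma prod_cancel s : all (leq 1) s ->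
  \prod_(k <- s) (1 - q ^+ k) * \prod_(k <- s) i k = 1.
Proof.
move=> /allP s0; rewrite -big_split big_seq big1 //= => k /s0 k0.
exact: mulr_iv.
Qed.

Lemma diff_terms01 m : t m 0 + t m 1 =
  (q ^+ m.+1 * (1 - q) * (1 - q ^+ (m + 3)) * (1 - q ^+ m.+2) +
   q ^+ (2 * m + 6) * ((1 - q ^+ m) + (1 - q ^+ 3) * q ^+ m.+1)) *
  \prod_(k <- iota 2 m.+1) i k.
Proof.
have -> : \prod_(k <- iota 2 m.+1) i k = (1 - q) * iqf m.+2.
  by rewrite iqfE [X in _ = _ * X]big_cons mulrA -{1}[q]expr1 (h 0) mul1r.
rewrite diff_term0 (diff_term1 qN) -(iqfSK qN m.+1); ring.
Qed.

(** Multiplied by (1 - q^2) ... (1 - q^(m + 2)), the bound becomes a polynomial identity that [ring]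
    decides; [e] collects the exceptional powers of q. *)
Lemma diff_certificate m L e : (1 < m)%N ->
  all (fun c => submultiset c.2 (iota 2 m.+1)) L ->
  q ^+ m.+1 * (1 - q) * (1 - q ^+ (m + 3)) * (1 - q ^+ m.+2) +
   q ^+ (2 * m + 6) * ((1 - q ^+ m) + (1 - q ^+ 3) * q ^+ m.+1) +
   e * \prod_(k <- iota 2 m.+1) (1 - q ^+ k) = certificate q L ->
  nn (D m.+1 + e).
Proof.
move=> m1 sL cL; have s0 : all (leq 1) (iota 2 m.+1).
  by apply/allP => k; rewrite mem_iota; lia.
apply: nonneg_le (nonneg_certificate qN s0 sL).
rewrite -cL mulrDl -diff_terms01 -mulrA prod_cancel // mulr1 opprD addrACA subrr addr0.
exact: diff_tail.
Qed.

(* The certificates below were found by linear programming. *)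
Lemma diff3_low : nn (D 3 + (q ^+ 4 + q ^+ 8 + q ^+ 10 + q ^+ 16 - q ^+ 9)).
Proof.
apply: (@diff_certificate 2 [:: (3, [:: 2; 3; 4]); (5, [:: 2; 3; 4]); (9, [:: 3]);
  (15, [:: 2; 4]); (17, [:: 2; 3]); (23, [:: 2])]%N) => //.
by certificate_ring.
Qed.

(** The surplus q^12 serves l = 7, where 4 = N - l - 1; so do q^9 in row 3 for l = 5 and q^17 in row
    5 for l = 11. *)
Lemma diff4_low : nn (D 4 + (q ^+ 5 + q ^+ 9 + q ^+ 13 - q ^+ 12)).
Proof.
apply: (@diff_certificate 3 [:: (4, [:: 3; 4; 5]); (14, [:: 3]); (16, [:: 3]);
  (16, [:: 2; 3; 5]); (22, [:: 2; 3])]%N) => //.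
by certificate_ring.
Qed.

Lemma diff5_low : nn (D 5 + (q ^+ 6 + q ^+ 12 - q ^+ 17)).
Proof.
apply: (@diff_certificate 4 [:: (5, [:: 2; 3; 4; 5; 6]); (7, [:: 2; 3; 4; 5]);
  (9, [:: 2; 3; 4; 5; 6]); (11, [:: 2; 3; 4; 5; 6]); (13, [:: 2; 3; 4; 5; 6]);
  (13, [:: 2; 3; 4; 5; 6]); (15, [:: 2; 3; 4; 5]); (15, [:: 2; 3; 6]);
  (17, [:: 2; 3; 4; 5; 6]); (17, [:: 2; 4]); (17, [:: 3; 4; 6]); (19, [:: 2; 4]);
  (19, [:: 3; 4; 5; 6]); (19, [:: 3; 5]); (21, [:: 2; 3; 5; 6]); (21, [:: 5; 6]);
  (23, [:: 2; 3; 6]); (23, [:: 2; 4; 6]); (25, [:: 2; 3; 6]); (26, [:: 2; 3; 5]);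
  (26, [:: 3; 5]); (29, [:: 2; 3]); (29, [:: 3; 5]); (30, [:: 5]); (31, [:: 2; 3]);
  (31, [:: 2; 3]); (35, [:: 2])]%N) => //.
by certificate_ring.
Qed.

(** By [iv23] the term n = 0 has few denominators. Only the part q^16 / ((1 - q^3) (1 - q^6)) of the
    term n = 1 enters the certificate, which keeps it small. *)
Lemma diff6_low : nn (D 6 + (q ^+ 7 + q ^+ 13)).
Proof.
have t0E : t 5 0 = q ^+ 6 * (1 + q ^+ 4) * (1 - q + q ^+ 2) * i 5 * i 6 * i 6.
  rewrite diff_term0 !iqfS iqf0 mul1r.
  transitivity (q ^+ 6 * (1 + q ^+ 4) * ((1 - q ^+ 1) * i 1) * ((1 - q) * i 2 * i 3) *
    ((1 - q ^+ 4) * i 4) * i 5 * i 6); first by ring.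
  by rewrite !h iv23 //; ring.
have t1E : t 5 1 = q ^+ 16 * i 2 * i 3 * i 4 * i 6 * i 7 + q ^+ 22 * i 2 * i 4 * i 5 * i 6 * i 7.
  rewrite (diff_term1 qN) !iqfS iqf0 mul1r.
  transitivity (((1 - q ^+ 1) * i 1) * (q ^+ 16 * i 2 * i 3 * i 4 * ((1 - q ^+ 5) * i 5) * i 6 * i 7
   + q ^+ 22 * i 2 * ((1 - q ^+ 3) * i 3) * i 4 * i 5 * i 6 * i 7)); first by ring.
  by rewrite !h; ring.
apply: nonneg_le (@nonneg_certificate A N q qN [:: (6, [:: 3; 5]); (8, [:: 3; 5]);
  (10, [:: 3; 5]); (15, [:: 3; 5; 6]); (16, [:: 3; 5; 6]); (18, [:: 6; 6]); (20, [:: 3; 6]);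
  (22, [:: 3; 5]); (24, [:: 3; 5]); (25, [:: 3; 5]); (27, [:: 3]); (29, [:: 3])]%N
  [:: 3; 5; 6; 6]%N isT isT).
have -> : certificate q [:: (6, [:: 3; 5]); (8, [:: 3; 5]);
  (10, [:: 3; 5]); (15, [:: 3; 5; 6]); (16, [:: 3; 5; 6]); (18, [:: 6; 6]); (20, [:: 3; 6]);
  (22, [:: 3; 5]); (24, [:: 3; 5]); (25, [:: 3; 5]); (27, [:: 3]); (29, [:: 3])]%N =
  q ^+ 6 * (1 + q ^+ 4) * (1 - q + q ^+ 2) * (1 - q ^+ 3) +
  q ^+ 16 * ((1 - q ^+ 5) * (1 - q ^+ 6)) +
  (q ^+ 7 + q ^+ 13) * ((1 - q ^+ 3) * (1 - q ^+ 5) * (1 - q ^+ 6) * (1 - q ^+ 6)).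
  by certificate_ring.
rewrite !big_cons big_nil.
rewrite [X in nn (_ - X)](_ : _ = t 5 0 + q ^+ 16 * i 3 * i 6 + (q ^+ 7 + q ^+ 13)); last first.
  rewrite t0E; transitivity (q ^+ 6 * (1 + q ^+ 4) * (1 - q + q ^+ 2) * ((1 - q ^+ 3) * i 3) *
    i 5 * i 6 * i 6
    + q ^+ 16 * i 3 * i 6 * ((1 - q ^+ 5) * i 5) * ((1 - q ^+ 6) * i 6) +
    (q ^+ 7 + q ^+ 13) * ((1 - q ^+ 3) * i 3) * ((1 - q ^+ 5) * i 5) * ((1 - q ^+ 6) * i 6) *
      ((1 - q ^+ 6) * i 6));
    first by ring.
  by rewrite !h !mulr1.
have := @diff_tail A N q qN 5 isT => dt.
rewrite [X in nn X](_ : _ = (D 6 - (t 5 0 + t 5 1)) + q ^+ 22 * i 2 * i 4 * i 5 * i 6 * i 7 +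
  q ^+ 16 * i 3 * i 6 * ((i 2 - 1) * i 4 * i 7 + (i 4 - 1) * i 7 + (i 7 - 1))).
  by nonneg_tac.
by rewrite t1E; ring.
Qed.

(** The surplus q^9 + q^21 / (1 - q^2) will pay for the deficits of row 2. *)
Lemma diff7_low : nn (D 7 + (q ^+ 8 - q ^+ 9 - q ^+ 21 * i 2)).
Proof.
have t0E : t 6 0 = q ^+ 7 * (1 - q + q ^+ 2) * i 4 * i 5 * i 6 * i 6 +
    q ^+ 14 * quot N q 3 7.
  rewrite diff_term0 !iqfS iqf0 mul1r /quot -[index_iota 3 8]/[:: 3; 4; 5; 6; 7]%N.
  rewrite !big_cons big_nil.
  transitivity (((1 - q ^+ 1) * i 1) * (q ^+ 7 * ((1 - q) * i 2 * i 3) *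
     i 4 * i 5 * i 6 * ((1 - q ^+ 7) * i 7) +
     q ^+ 14 * ((1 - q ^+ 2) * i 2) * (1 - q) * i 3 * i 4 * i 5 * i 6 * i 7)); first by ring.
  by rewrite !h iv23 //; ring.
have t1E : t 6 1 = q ^+ 18 * i 2 * i 3 * i 4 * i 5 * i 7 * i 8 +
    q ^+ 25 * i 2 * i 4 * i 5 * i 6 * i 7 * i 8.
  rewrite (diff_term1 qN) !iqfS iqf0 mul1r.
  transitivity (((1 - q ^+ 1) * i 1) * (q ^+ 18 * i 2 * i 3 * i 4 * i 5 * ((1 - q ^+ 6) * i 6) *
    i 7 * i 8
   + q ^+ 25 * i 2 * ((1 - q ^+ 3) * i 3) * i 4 * i 5 * i 6 * i 7 * i 8)); first by ring.
  by rewrite !h; ring.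
(* This isolates q^3 / (1 - q^2); with the factor q^18 of the term n = 1 it becomes the surplus q^21
   / (1 - q^2). *)
have i23 : i 2 * i 3 = q ^+ 3 * i 2 + (1 + q ^+ 2 + q ^+ 4) * i 6 + q ^+ 6 * i 2 * i 3.
  have E : i 2 * i 3 = q ^+ 3 * i 2 * ((1 - q ^+ 3) * i 3) + i 2 * ((1 - q ^+ 3) * i 3)  +
    q ^+ 6 * i 2 * i 3 by ring.
  have E' : i 2 * ((1 - q ^+ 6) * i 6) = ((1 - q ^+ 2) * i 2) * (1 + q ^+ 2 + q ^+ 4) * i 6 by ring.
  by rewrite !h !mulr1 mul1r in E E'; rewrite {1}E {2}E'.
apply: nonneg_le (@nonneg_certificate A N q qN [:: (7, [:: 5; 6; 6]); (13, [:: 4; 5; 6; 6]);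
   (13, [:: 5]); (15, [:: 4; 5]); (17, [::]); (17, [:: 5; 6; 6]); (19, [:: 4]);
   (19, [:: 5; 6; 6]); (21, [:: 4; 5; 6]); (25, [:: 5; 6])]%N
  [:: 4; 5; 6; 6]%N isT isT).
have -> : certificate q [:: (7, [:: 5; 6; 6]); (13, [:: 4; 5; 6; 6]);
   (13, [:: 5]); (15, [:: 4; 5]); (17, [::]); (17, [:: 5; 6; 6]); (19, [:: 4]);
   (19, [:: 5; 6; 6]); (21, [:: 4; 5; 6]); (25, [:: 5; 6])]%N =
  q ^+ 7 * (1 - q + q ^+ 2) + q ^+ 20 * ((1 - q ^+ 4) * (1 - q ^+ 5) * (1 - q ^+ 6)) +
  (q ^+ 14 * (1 - q) + q ^+ 8 - q ^+ 9) * ((1 - q ^+ 4) * (1 - q ^+ 5) * (1 - q ^+ 6) * (1 -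
    q ^+ 6)).
  by certificate_ring.
rewrite !big_cons big_nil.
rewrite [X in nn (_ - X)](_ : _ = q ^+ 7 * (1 - q + q ^+ 2) * i 4 * i 5 * i 6 * i 6 +
    q ^+ 20 * i 6 + (q ^+ 14 * (1 - q) + q ^+ 8 - q ^+ 9)); last first.
  transitivity (q ^+ 7 * (1 - q + q ^+ 2) * i 4 * i 5 * i 6 * i 6 +
    q ^+ 20 * i 6 * ((1 - q ^+ 4) * i 4) * ((1 - q ^+ 5) * i 5) * ((1 - q ^+ 6) * i 6) +
    (q ^+ 14 * (1 - q) + q ^+ 8 - q ^+ 9) * ((1 - q ^+ 4) * i 4) * ((1 - q ^+ 5) * i 5) * ((1 -
      q ^+ 6) * i 6) * ((1 - q ^+ 6) * i 6));
    first by ring.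
  by rewrite !h !mulr1.
have := @diff_tail A N q qN 6 isT => dt.
have := @quot3_low A N q qN 7 isT => ql.
rewrite [X in nn X](_ : _ = (D 7 - (t 6 0 + t 6 1)) + q ^+ 25 * i 2 * i 4 * i 5 * i 6 * i 7 * i 8 +
  q ^+ 14 * ((quot N q 3 7 + q - (1 + q ^+ 3 + q ^+ 10) - q ^+ 9) + q ^+ 3 + q ^+ 10 + q ^+ 9) +
  q ^+ 18 * i 2 * i 3 * ((i 4 - 1) * i 5 * i 7 * i 8 + (i 5 - 1) * i 7 * i 8 +
     (i 7 - 1) * i 8 + (i 8 - 1)) +
  q ^+ 18 * ((1 + q ^+ 4) * i 6 + q ^+ 6 * i 2 * i 3)).
  by nonneg_tac.
rewrite t0E t1E.
have -> : q ^+ 21 * i 2 = q ^+ 18 * (i 2 * i 3 - (1 + q ^+ 2 + q ^+ 4) * i 6 - q ^+ 6 * i 2 * i 3).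
  by rewrite {1}i23; ring.
ring.
Qed.

End RowsThreeToSeven.

(** * Row 2, where every term of the sum has a deficit *)

Section RowTwo.
Variables (A : comNzRingType) (N : nat) (q : A).
Hypothesis qN : q ^+ N.+1 = 0.
Local Notation i k := (iv N q k).
Local Notation iqf := (iqf N q).
Local Notation nn := (nonneg q).
Local Notation D m := (crank_row N q m - crank_row N q m.+1).
Local Notation t := (diff_term N q).

Let h k : (1 - q ^+ k.+1) * i k.+1 = 1 := mulr_iv qN (ltn0Sn k).
(** In row 2 the factor 1 - q occurs three times against two q-factorials, so a term - q survives
    for every n and not only for n = 0. *)
Definition quot_sq n : A := (1 - q) ^+ 3 * iqf n * iqf n.+2.

(** Passing from n to n + 1 divides by 1 - q^(n + 1) and by 1 - q^(n + 3); the reserves q^(n + 2)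
    and q^(n + 4) are what the two uses of [quot_step] consume. *)
Lemma quot_sq_low n : (3 <= n)%N ->
  nn (quot_sq n + q - (1 + q ^+ 2 + q ^+ (n + 4)) - q ^+ n.+2).
Proof.
move=> n3; rewrite -(subnKC n3); elim: (n - 3)%N => [|j IH].
  pose X : A := i 4 + q ^+ 10 * i 4 * i 5 + q ^+ 2 * i 4 * i 6 + q ^+ 12 * i 4 * i 5 * i 6.
  have nX : nn (X - 1 - q ^+ 2 - q ^+ 4 - q ^+ 8) by exact: nonneg_X.
  have -> : quot_sq (3 + 0) = (X - q) * i 2 * i 3.
    rewrite /quot_sq addn0 !iqfS iqf0 mul1r -[X - q](quot25 qN).
    transitivity (((1 - q ^+ 1) * i 1) * ((1 - q ^+ 1) * i 1) *
       ((1 - q) * i 2 * i 3 * i 4 * i 5) * i 2 * i 3); first by ring.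
    by rewrite !h; ring.
  have E : (X - q) * i 2 * i 3 + q * ((1 - q ^+ 2) * i 2) * ((1 - q ^+ 3) * i 3) =
    (X - 1 - q ^+ 4) * i 2 * i 3 + i 2 * ((1 - q ^+ 3) * i 3) + q ^+ 6 * i 2 * i 3 by ring.
  rewrite !h !mulr1 in E; rewrite E addn0.
  rewrite [X in nn X](_ : _ = (X - 1 - q ^+ 2 - q ^+ 4 - q ^+ 8) * i 2 * i 3 + q ^+ 8 * i 2 * i 3 +
     (i 2 - 1) + q ^+ 2 * (i 2 * i 3 - 1 - q ^+ 3 - q ^+ 5) + q ^+ 6 * i 2 * i 3); last by ring.
  suff : nn (i 2 * i 3 - 1 - q ^+ 3 - q ^+ 5) by nonneg_tac.
  rewrite [X in nn X](_ : _ = (i 2 - 1 - q ^+ 2) * i 3 + (i 3 - 1 - q ^+ 3) +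
     q ^+ 2 * (i 3 - 1 - q ^+ 3) + q ^+ 2); last by ring.
  by have := @iv_ge2 A N q qN 2 isT; have := @iv_ge2 A N q qN 3 isT; nonneg_tac.
rewrite addnS; set n' := (3 + j)%N in IH *.
have := @quot_step A N q qN (quot_sq n') (1 + q ^+ 2 + q ^+ (n' + 4)) n'.+1 isT IH.
set R := (1 + q ^+ 2 + q ^+ (n' + 4)) * i n'.+1.
rewrite [X in nn X](_ : _ = quot_sq n' * i n'.+1 + q - (R - q ^+ n'.+4) - q ^+ n'.+4); last by ring.
move/(@quot_step A N q qN _ _ n'.+3 isT); apply: nonneg_le.
have -> : quot_sq n'.+1 = quot_sq n' * i n'.+1 * i n'.+3.
  by rewrite /quot_sq !iqfS; ring.
have i1 := @iv_ge2 A N q qN n'.+1 isT; have i3 := @iv_ge2 A N q qN n'.+3 isT.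
rewrite [X in nn X](_ : _ = ((1 + q ^+ 2) * (i n'.+1 - 1) + q ^+ n'.+4 * (i n'.+1 - 1)) * i n'.+3
  + (1 + q ^+ 2) * (i n'.+3 - 1 - q ^+ n'.+3)); first by nonneg_tac.
rewrite /R addn4 addSn addn4 [q ^+ n'.+4.+1]exprS [q ^+ n'.+4]exprS; ring.
Qed.

Lemma diff_term_sq n : (3 <= n)%N -> nn (t 1 n + q ^+ (n * n + 5 * n + 3)).
Proof.
move=> n3; have ql := quot_sq_low n3.
have h2 : nn (iqf n * (1 - q)).
  have a : all (fun k => 0 < k <= n)%N [:: 1%N] by rewrite /=; lia.
  by have := nonneg_iqf_cancel qN (isT : uniq [:: 1%N]) a; rewrite big_seq1 expr1 mulrC.
have h3 : nn (iqf n.+2 * ((1 - q) * (1 - q ^+ 3))).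
  have a : all (fun k => 0 < k <= n.+2)%N [:: 1%N; 3%N] by rewrite /=; lia.
  by have := nonneg_iqf_cancel qN (isT : uniq [:: 1%N; 3%N]) a;
    rewrite !big_cons big_nil mulr1 expr1 mulrC.
rewrite [X in nn X](_ : _ = q ^+ (n * n + 5 * n + 2) *
  ((quot_sq n + q - (1 + q ^+ 2 + q ^+ (n + 4)) - q ^+ n.+2) +
   (1 + q ^+ 2 + q ^+ (n + 4)) + q ^+ n.+2 +
   q ^+ n.+1 * (iqf n * (1 - q)) * (iqf n.+2 * ((1 - q) * (1 - q ^+ 3))))).
  by nonneg_tac.
rewrite /diff_term /rect addn2 (_ : (n * n + 5 * n + 2 = (n + n.+2 + n * n.+2) + n)%N); last by lia.
rewrite (_ : (n * n + 5 * n + 3 = ((n + n.+2 + n * n.+2) + n).+1)%N); last by lia.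
rewrite [q ^+ (_ + n).+1]exprS [q ^+ (_ + _ +
  n)]exprD add1n [q ^+ n.+1]exprS [q ^+ n.+2]exprS [q ^+ n.+1]exprS /quot_sq.
ring.
Qed.

Lemma iv2_shift e : nn (i 2 - q ^+ (2 * e) * i 2).
Proof.
elim: e => [|e IH]; first by rewrite muln0 expr0 mul1r subrr; exact: nonneg0.
rewrite [X in nn X](_ : _ = (i 2 - q ^+ (2 * e) * i 2) + q ^+ (2 * e) * ((1 - q ^+ 2) * i 2)).
  by rewrite h; nonneg_tac.
by rewrite mulnS exprD; ring.
Qed.

(* The exponents 27 + n^2 + 11 n of the negative terms in diff_term_sq are odd, so
   q^27 / (1 - q^2) dominates their sum. *)
Lemma sparse_sum K :
  nn (i 2 - \sum_(n < K) q ^+ (n * n + 11 * n) - q ^+ (K * K + 11 * K) * i 2).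
Proof.
elim: K => [|K IH].
  by rewrite big_ord0 expr0 mul1r subr0 subrr; exact: nonneg0.
rewrite big_ord_recr /=.
have s := iv2_shift (K + 5).
rewrite [X in nn X](_ : _ = (i 2 - \sum_(n < K) q ^+ (n * n + 11 * n) - q ^+ (K * K + 11 * K) *
  i 2) +
  q ^+ (K * K + 11 * K) * (q ^+ 2 * (i 2 - q ^+ (2 * (K + 5)) * i 2))).
  by nonneg_tac.
rewrite (_ : (K.+1 * K.+1 + 11 * K.+1 = (K * K + 11 * K) + (2 + 2 * (K + 5)))%N); last by lia.
rewrite [q ^+ (K * K + 11 * K + (2 + 2 * (K + 5)))]exprD [q ^+ (2 + _)]exprD.
have E : i 2 = 1 + q ^+ 2 * i 2 by exact: ivE.
set u := q ^+ (K * K + 11 * K); set v := q ^+ (2 * (K + 5)).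
transitivity (i 2 - \sum_(n < K) q ^+ (n * n + 11 * n) - u * (1 + q ^+ 2 * i 2) +
  u * (q ^+ 2 * (i 2 - v * i 2))); first by ring.
by rewrite -E.
Qed.

Lemma diff2_low : nn (D 2 + (q ^+ 3 + q ^+ 5 + q ^+ 9 + q ^+ 15 + q ^+ 17 + q ^+ 21 +
  q ^+ 27 * i 2)).
Proof.
have t0E : t 1 0 = (1 - q) * (q ^+ 2 + q ^+ 4).
  rewrite diff_term0 !iqfS iqf0 mul1r.
  transitivity (((1 - q ^+ 1) * i 1) * ((1 - q ^+ 2) * i 2) * ((1 - q) * (q ^+ 2 + q ^+ 4)));
    first by ring.
  by rewrite !h; ring.
have t1E : t 1 1 = q ^+ 8 * (1 - q + q ^+ 2) * i 6 + q ^+ 10 * i 2.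
  rewrite (diff_term1 qN) !iqfS iqf0 mul1r.
  transitivity (((1 - q ^+ 1) * i 1) * (q ^+ 8 * ((1 - q) * i 2 * i 3) +
     q ^+ 10 * i 2 * ((1 - q ^+ 3) * i 3))); first by ring.
  by rewrite !h iv23 //; ring.
have t2E : t 1 2 = q ^+ 16 * (1 - q + q ^+ 2) * i 6 * i 2 * i 4 + q ^+ 19 * i 2 * i 2 * i 4.
  rewrite /diff_term /rect !iqfS iqf0 mul1r.
  transitivity (((1 - q ^+ 1) * i 1) * ((1 - q ^+ 1) * i 1) *
    (q ^+ 16 * ((1 - q) * i 2 * i 3) * i 2 * i 4 +
     q ^+ 19 * i 2 * ((1 - q ^+ 3) * i 3) * i 2 * i 4)); first by ring.
  by rewrite !h iv23 //; ring.
pose Q := q ^+ 3 + q ^+ 5 + q ^+ 9 + q ^+ 15 + q ^+ 17 + q ^+ 21.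
have low : nn (t 1 0 + t 1 1 + t 1 2 + Q).
  have := @nonneg_certificate A N q qN [:: (2, [:: 2; 2; 4; 6]); (4, [:: 2; 2; 4]);
    (8, [:: 2; 2; 4]); (10, [:: 2; 2; 4; 6]); (12, [:: 2; 2; 4; 6]); (14, [:: 4; 6]);
    (22, [:: 4; 6]); (23, [:: 2]); (25, [:: 2; 2]); (27, [:: 2; 2]); (28, [:: 2]);
    (29, [:: 2; 2]); (30, [:: 2; 2]); (31, [:: 2; 2]); (31, [:: 2; 2]); (32, [:: 2]);
    (33, [:: 2])]%N [:: 2; 2; 4; 6]%N isT isT.
  rewrite [X in nn (X * _)](_ : _ = ((1 - q) * (q ^+ 2 + q ^+ 4) + Q) *
     ((1 - q ^+ 2) * (1 - q ^+ 2) * (1 - q ^+ 4) * (1 - q ^+ 6)) +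
     q ^+ 8 * (1 - q + q ^+ 2) * ((1 - q ^+ 2) * (1 - q ^+ 2) * (1 - q ^+ 4)) +
     q ^+ 10 * ((1 - q ^+ 2) * (1 - q ^+ 4) * (1 - q ^+ 6)) +
     q ^+ 16 * (1 - q + q ^+ 2) * (1 - q ^+ 2) + q ^+ 19 * (1 - q ^+ 6)); last first.
    by rewrite /Q; certificate_ring.
  rewrite !big_cons big_nil; congr (nn _).
  rewrite t0E t1E t2E.
  transitivity (((1 - q) * (q ^+ 2 + q ^+ 4) + Q) *
     ((1 - q ^+ 2) * i 2) * ((1 - q ^+ 2) * i 2) * ((1 - q ^+ 4) * i 4) * ((1 - q ^+ 6) * i 6) +
     q ^+ 8 * (1 - q + q ^+ 2) * i 6 * ((1 - q ^+ 2) * i 2) * ((1 - q ^+ 2) * i 2) * ((1 -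
       q ^+ 4) * i 4) +
     q ^+ 10 * i 2 * ((1 - q ^+ 2) * i 2) * ((1 - q ^+ 4) * i 4) * ((1 - q ^+ 6) * i 6) +
     q ^+ 16 * (1 - q + q ^+ 2) * i 6 * i 2 * i 4 * ((1 - q ^+ 2) * i 2) +
     q ^+ 19 * i 2 * i 2 * i 4 * ((1 - q ^+ 6) * i 6)); first by ring.
  by rewrite !h !mulr1; ring.
have tail : nn (\sum_(n < N.+1) (t 1 (n + 3) + q ^+ 27 * q ^+ (n * n + 11 * n))).
  apply: nonneg_sum => n _; rewrite -exprD.
  rewrite (_ : (27 + (n * n + 11 * n) = (n + 3) * (n + 3) + 5 * (n + 3) + 3)%N); last by lia.
  by apply: diff_term_sq; rewrite leq_addl.
have sp := sparse_sum N.+1.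
rewrite (expr_nil qN) ?mul0r ?subr0 in sp; last by nia.
rewrite (diff_sum qN 1 3).
have -> : \sum_(n < 3) t 1 n = t 1 0 + t 1 1 + t 1 2 by rewrite !big_ord_recr big_ord0 /= add0r.
rewrite big_split /= -mulr_sumr in tail.
rewrite [X in nn X](_ : _ = (t 1 0 + t 1 1 + t 1 2 + Q) +
  (\sum_(n < N.+1) t 1 (n + 3) + q ^+ 27 * \sum_(n < N.+1) q ^+ (n * n + 11 * n)) +
  q ^+ 27 * (i 2 - \sum_(n < N.+1) q ^+ (n * n + 11 * n))); first by nonneg_tac.
by rewrite /Q; ring.
Qed.

End RowTwo.

(** * Theta series *)

(* The n-th term (-1)^n a^(n (n + 1) / 2) b^(n (n - 1) / 2) of Ramanujan's theta
   series f(- a, - b). *)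
Definition bilateral (A : comNzRingType) (a b : A) (j : int) : A :=
  match j with
  | Posz n => (-1) ^+ n * a ^+ 'C(n.+1, 2) * b ^+ 'C(n, 2)
  | Negz n => (-1) ^+ n.+1 * a ^+ 'C(n.+1, 2) * b ^+ 'C(n.+2, 2)
  end.

(** The sum over - K <= j < K, arranged by pairs j, - 1 - j: this reflection fixes j (j + 1) / 2,
    and all later cancellations are along it. *)
Definition bsum (A : comNzRingType) (K : nat) (F : int -> A) : A :=
  \sum_(n < K) (F (Posz n) + F (Negz n)).

Lemma binS2 n : 'C(n.+1, 2) = ('C(n, 2) + n)%N.
Proof. by rewrite binS bin1. Qed.

Lemma bilateral_sym (A : comNzRingType) (a b : A) (j : int) :
  bilateral b a (- j) = bilateral a b j.
Proof.
case: j => [[|n]|n].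
- by rewrite oppr0 /= !expr0.
- by rewrite -NegzE /= mulrAC.
- by rewrite NegzE opprK /= mulrAC.
Qed.

(** The ratio of consecutive terms is - a (a b)^j; it is multiplied by (a b)^(n - j) so that no
    negative power appears when j is negative. *)
Lemma bilateral_step (A : comNzRingType) (a b : A) n (j : int) : j <= n%:Z ->
  a * (a * b) ^+ n * bilateral a b j =
  - ((a * b) ^+ `|n%:Z - j|%N * bilateral a b (j + 1)).
Proof.
case: j => [j|j] jn.
  have {}jn : (j <= n)%N by lia.
  have -> : `|n%:Z - j%:Z|%N = (n - j)%N by lia.
  have -> : Posz j + 1 = Posz j.+1 by rewrite -addn1.
  rewrite /= (binS2 j.+1) (binS2 j) -{1}(subnK jn) !exprD [(a * b) ^+ j]exprMn.
  by rewrite [(-1) ^+ j.+1]exprS [a ^+ j.+1]exprS; ring.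
have -> : `|n%:Z - Negz j|%N = (n + j.+1)%N by lia.
case: j jn => [|j] _.
  rewrite /= !binS2 bin0n /= !exprD !expr0 !expr1 exprMn !mulr1; ring.
have -> : Negz j.+1 + 1 = Negz j by rewrite !NegzE; lia.
rewrite /= (binS2 j.+2) (binS2 j.+1) !exprD [(a * b) ^+ j.+2]exprMn.
rewrite [(-1) ^+ j.+2]exprS [a ^+ j.+2]exprS.
by ring.
Qed.

Section JacobiTripleProduct.
Variables (A : comNzRingType) (N : nat) (q : A).
Hypothesis qN : q ^+ N.+1 = 0.
Local Notation iqf := (iqf N q).

Definition qfact n : A := \prod_(k < n) (1 - q ^+ k.+1).

Lemma qfactS n : qfact n.+1 = qfact n * (1 - q ^+ n.+1).
Proof. by rewrite /qfact big_ord_recr. Qed.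

Lemma qfact_iqf n : qfact n * iqf n = 1.
Proof.
elim: n => [|n IH]; first by rewrite /qfact big_ord0 iqf0 mulr1.
by rewrite qfactS -mulrA iqfSK.
Qed.

Lemma qfact_stable n : (N <= n)%N -> qfact n = qfact N.
Proof.
move=> Nn; rewrite -(subnKC Nn); elim: (n - N)%N => [|k IH]; first by rewrite addn0.
by rewrite addnS qfactS IH (expr_nil qN) ?subr0 ?mulr1 // ltnS leq_addr.
Qed.

Definition gauss n k : A := qfact n * iqf k * iqf (n - k).

Lemma gauss0 n : gauss n 0 = 1.
Proof. by rewrite /gauss iqf0 mulr1 subn0 qfact_iqf. Qed.

Lemma gaussn n : gauss n n = 1.
Proof. by rewrite /gauss subnn iqf0 mulr1 qfact_iqf. Qed.

Lemma gaussS n k : (k < n)%N ->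
  gauss n.+1 k.+1 = gauss n k.+1 + q ^+ (n - k) * gauss n k.
Proof.
move=> kn; rewrite /gauss subSS qfactS.
have -> : (n - k = (n - k.+1).+1)%N by lia.
rewrite -(iqfSK qN k) -(iqfSK qN (n - k.+1)).
have -> : q ^+ n.+1 = q ^+ k.+1 * q ^+ (n - k.+1).+1.
  by rewrite -exprD; congr (_ ^+ _); lia.
ring.
Qed.

(** By the q-Pascal rule [gaussS], terms with the ratio of a theta series absorb one more linear
    factor when n is raised by 1. *)
Lemma gauss_sum n (x : A) (u : nat -> A) :
  (forall i, (i <= n)%N -> x * u i = - (q ^+ (n - i) * u i.+1)) ->
  (1 - x) * \sum_(i < n.+1) gauss n i * u i = \sum_(i < n.+2) gauss n.+1 i * u i.
Proof.
move=> xu; have -> : (1 - x) * \sum_(i < n.+1) gauss n i * u i =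
    \sum_(i < n.+1) gauss n i * u i + \sum_(i < n.+1) gauss n i * (q ^+ (n - i) * u i.+1).
  rewrite mulrBl mul1r mulr_sumr -sumrN; congr (_ + _); apply: eq_bigr => i _.
  by rewrite mulrCA xu ?mulrN ?opprK // -ltnS.
rewrite [in RHS]big_ord_recl [X in X + _]big_ord_recl [X in _ + X]big_ord_recr /=.
rewrite !gauss0 gaussn subnn expr0 !mul1r -addrA; congr (_ + _).
rewrite addrA -big_split big_ord_recr /= gaussn mul1r; congr (_ + _).
by apply: eq_bigr => i _; rewrite /bump /= add1n gaussS //; ring.
Qed.

(** The finite Jacobi triple product, built factor by factor. The case n = 0 is the same induction
    with a and b exchanged, followed by a reversal of the sum. *)
Lemma finite_triple_product a b n m : a * b = q ->
  (\prod_(k < n) (1 - a * q ^+ k)) * (\prod_(k < m) (1 - b * q ^+ k)) =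
  \sum_(i < (n + m).+1) gauss (n + m) i * bilateral a b (i%:Z - m%:Z).
Proof.
move=> abq; elim: n => [|n IH].
  rewrite big_ord0 mul1r add0n.
  transitivity (\sum_(i < m.+1) gauss m i * bilateral b a i%:Z).
    elim: m => [|m IH].
      by rewrite big_ord0 big_ord_recr big_ord0 /= gaussn !expr0 !mulr1 add0r.
    rewrite big_ord_recr [LHS]mulrC IH.
    apply: (@gauss_sum m (b * q ^+ m) (fun i => bilateral b a i%:Z)) => i im.
    have := @bilateral_step _ b a m i%:Z; rewrite [b * a]mulrC abq => -> //.
    congr (- (_ ^+ _ * bilateral _ _ _)); lia.
  rewrite [LHS](reindex_inj rev_ord_inj); apply: eq_bigr => i _.
  rewrite -[nat_of_ord (rev_ord i)]/(m.+1 - i.+1)%N.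
  have im : (i <= m)%N by rewrite -ltnS.
  rewrite subSS; congr (_ * _); first by rewrite /gauss subKn // mulrAC.
  have -> : i%:Z - m%:Z = - (m - i)%N%:Z by lia.
  by rewrite bilateral_sym.
rewrite big_ord_recr mulrAC [LHS]mulrC IH addSn.
apply: (@gauss_sum (n + m) (a * q ^+ n) (fun i => bilateral a b (i%:Z - m%:Z))) => i im.
have := @bilateral_step _ a b n (i%:Z - m%:Z); rewrite abq => -> //; last by lia.
congr (- (_ ^+ _ * bilateral _ _ _)); lia.
Qed.

(** The factors of (q; q)_K missing from (q; q)_(K - j) are 1 - q^e with e > K - j, and each of them
    acts on x as 1. *)
Lemma qfact_absorb K j x : (j <= K)%N -> q ^+ (K - j).+1 * x = 0 ->
  qfact K * iqf (K - j) * x = x.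
Proof.
move=> jK hx; rewrite -{1}(subnKC (leq_subr j K)).
have -> : (K - (K - j) = j)%N by lia.
move: (K - j)%N hx => k hx; elim: j {jK} => [|j IH].
  by rewrite addn0 qfact_iqf mul1r.
rewrite addnS qfactS.
have -> : qfact (k + j) * (1 - q ^+ (k + j).+1) * iqf k * x =
  qfact (k + j) * iqf k * x - qfact (k + j) * iqf k * q ^+ j * (q ^+ k.+1 * x).
  have -> : q ^+ (k + j).+1 = q ^+ j * q ^+ k.+1.
    by rewrite -exprD; congr (_ ^+ _); lia.
  by ring.
by rewrite hx mulr0 subr0 IH.
Qed.

Lemma bilateral_divisible a b j : a * b = q ->
  exists c, bilateral a b j = c * q ^+ 'C(`|j|, 2).
Proof.
move=> <-; case: j => [n|n] /=.
  by exists ((-1) ^+ n * a ^+ n); rewrite binS2 exprD exprMn; ring.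
by exists ((-1) ^+ n.+1 * b ^+ n.+1); rewrite (binS2 n.+1) exprD exprMn; ring.
Qed.

(** Multiplied by (q; q)_N, the Gaussian coefficients of the finite identity act as 1, since the
    term j is divisible by a power of q large enough for [qfact_absorb]. The extra term appears
    because the finite sum runs from - N - 1 to N + 1 while [bsum] stops at N. *)
Lemma triple_product a b : a * b = q ->
  qfact N * (\prod_(k < N.+1) (1 - a * q ^+ k)) * (\prod_(k < N.+1) (1 - b * q ^+ k)) =
  bsum N.+1 (bilateral a b) + bilateral a b N.+1.
Proof.
move=> abq; rewrite -mulrA finite_triple_product // mulr_sumr.
transitivity (\sum_(i < (N.+1 + N.+1).+1) bilateral a b (i%:Z - N.+1%:Z)).
  apply: eq_bigr => i _; have [c cE] := bilateral_divisible (i%:Z - N.+1%:Z) abq.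
  have i2 : (i <= N.+1 + N.+1)%N by rewrite -ltnS.
  pose j := `|i%:Z - N.+1%:Z|%N; have jN : (j <= N.+1)%N by lia.
  have hx : q ^+ (N.+1 - j).+1 * bilateral a b (i%:Z - N.+1%:Z) = 0.
    rewrite cE -/j mulrCA -exprD (expr_nil qN) ?mulr0 //.
    by case: (j) jN => [|k] kN; [lia | rewrite binS2; lia].
  rewrite mulrA -[RHS](qfact_absorb jN hx) (@qfact_stable N.+1) //; congr (_ * _).
  rewrite /gauss (@qfact_stable (N.+1 + N.+1)); last by lia.
  have st n : (N <= n)%N -> iqf n = iqf N.
    by move=> Nn; apply: (@mul_inv_inj _ _ _ _ _ (qfact_iqf n));
      rewrite qfact_iqf qfact_stable // qfact_iqf.
  have [iN|iN] := leqP i N.+1.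
    have -> : (N.+1 - j = i)%N by lia.
    rewrite (st (N.+1 + N.+1 - i)%N); last by lia.
    rewrite [LHS](_ : _ = (qfact N * iqf N) * (qfact N * iqf i)); last by ring.
    by rewrite qfact_iqf mul1r.
  have -> : (N.+1 - j = N.+1 + N.+1 - i)%N by lia.
  rewrite (st i); last by lia.
  rewrite [LHS](_ : _ = (qfact N * iqf N) * (qfact N * iqf (N.+1 + N.+1 - i))); last by ring.
  by rewrite qfact_iqf mul1r.
transitivity (\sum_(n < N.+1) bilateral a b (Negz n) + \sum_(n < N.+2) bilateral a b (Posz n)).
  rewrite -addnS big_split_ord; congr (_ + _); last first.
    apply: eq_bigr => i _; congr (bilateral a b _).
    by rewrite -[nat_of_ord (rshift _ i)]/(N.+1 + i)%N; lia.
  rewrite [LHS](reindex_inj rev_ord_inj); apply: eq_bigr => i _; congr (bilateral a b _).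
  rewrite -[nat_of_ord (lshift _ _)]/(N.+1 - i.+1)%N NegzE.
  by have := ltn_ord i; lia.
by rewrite [X in _ + X]big_ord_recr /bsum big_split addrA [X in X + _]addrC.
Qed.

End JacobiTripleProduct.

Definition tri (j : int) : nat :=
  match j with Posz n => 'C(n.+1, 2) | Negz n => 'C(n.+1, 2) end.

Lemma tri_double j : (tri j)%:Z * 2 = j * (j + 1).
Proof.
have h n : ('C(n.+1, 2) * 2 = n * n.+1)%N.
  by elim: n => // n IH; rewrite binS2 mulnDl IH; lia.
by case: j => n; have := h n; rewrite /tri ?NegzE; lia.
Qed.

Definition ibox (K : nat) : seq int := map Posz (iota 0 K) ++ map Negz (iota 0 K).

Lemma mem_ibox K j : (j \in ibox K) = (- K%:Z <= j < K%:Z).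
Proof.
rewrite mem_cat; case: j => n.
  rewrite mem_map ?mem_iota; last by move=> ? ? [].
  by rewrite [X in _ || X](_ : _ = false) ?orbF; [lia | apply/mapP => -[]].
rewrite [X in X || _](_ : _ = false) /=; last by apply/mapP => -[].
by rewrite mem_map ?mem_iota; [lia | move=> ? ? []].
Qed.

Lemma uniq_ibox K : uniq (ibox K).
Proof.
rewrite cat_uniq !map_inj_uniq ?iota_uniq; try by move=> ? ? [].
rewrite andbT /=; apply/hasPn => j /mapP[n _ ->]; apply/mapP => -[] //.
Qed.

Lemma bsumE (A : comNzRingType) K (F : int -> A) : bsum K F = \sum_(j <- ibox K) F j.
Proof.
rewrite /bsum big_split big_cat /= !big_map; congr (_ + _).
  by rewrite -(big_mkord xpredT (fun n => F (Posz n))) /index_iota subn0.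
by rewrite -(big_mkord xpredT (fun n => F (Negz n))) /index_iota subn0.
Qed.

Lemma sum_reindex (A : comNzRingType) (I J : eqType) (r : seq I) (s : seq J)
    (h : I -> J) (F : J -> A) :
  uniq r -> uniq s -> injective h -> {subset map h r <= s} ->
  (forall j, j \in s -> j \notin map h r -> F j = 0) ->
  \sum_(i <- r) F (h i) = \sum_(j <- s) F j.
Proof.
move=> ur us hinj hrs F0; rewrite -(big_map h xpredT F).
have /(perm_big _) -> : perm_eq s (map h r ++ filter (fun j => j \notin map h r) s).
  apply: uniq_perm => // [|j].
    rewrite cat_uniq map_inj_uniq // ur filter_uniq // andbT /=.
    by apply/hasPn => j; rewrite mem_filter => /andP[].
  rewrite mem_cat mem_filter; case: (boolP (j \in map h r)) => //= jr.
  by rewrite hrs.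
rewrite big_cat /= [X in _ + X]big_seq [X in _ + X]big1 ?addr0 // => j.
by rewrite mem_filter => /andP[jr js]; apply: F0.
Qed.

Section Theta.
Variables (A : comNzRingType) (N : nat) (e : int -> A).
Hypothesis e0 : e 0 = 1.
Hypothesis eD : forall i j, e (i + j) = e i * e j.

Lemma eX i n : e i ^+ n = e (i * n%:Z).
Proof.
elim: n => [|n IH]; first by rewrite mulr0 e0 expr0.
by rewrite exprS IH -eD; congr e; lia.
Qed.

(** The factor 1 - e (- a) is the one for k = 0 in the product over b = e (- a), which [qprod] does
    not contain. *)
Lemma theta (q : A) (a : int) : q ^+ N.+1 = 0 ->
  qprod N q 1 * (qprod N q (e a) * qprod N q (e (- a))) * (1 - e (- a)) =
  bsum N.+1 (fun j => (-1) ^+ `|j|%N * e (a * j) * q ^+ tri j).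
Proof.
move=> qN; have := @triple_product A N q qN (e a * q) (e (- a)).
rewrite mulrAC -eD subrr e0 mul1r => /(_ erefl).
have bE j : bilateral (e a * q) (e (- a)) j = (-1) ^+ `|j|%N * e (a * j) * q ^+ tri j.
  case: j => n; rewrite /bilateral /tri exprMn !eX -!mulrA; congr (_ * _).
    rewrite binS2 [q ^+ _ * _]mulrC mulrA -eD; congr (e _ * _); lia.
  rewrite (binS2 n.+1) [q ^+ _ * _]mulrC mulrA -eD NegzE; congr (e _ * _); lia.
rewrite bE [q ^+ tri N.+1](expr_nil qN) ?mulr0 ?addr0; last by rewrite /= binS2; lia.
have -> : bsum N.+1 (bilateral (e a * q) (e (- a))) =
  bsum N.+1 (fun j => (-1) ^+ `|j|%N * e (a * j) * q ^+ tri j).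
  by rewrite !bsumE; apply: eq_bigr => j _.
move=> <-.
have -> : \prod_(k < N.+1) (1 - e (- a) * q ^+ k) = (1 - e (- a)) * qprod N q (e (- a)).
  by rewrite big_ord_recl expr0 mulr1.
have -> : \prod_(k < N.+1) (1 - e a * q * q ^+ k) = qprod N q (e a).
  rewrite big_ord_recr /= -mulrA -exprS qN mulr0 subr0 mulr1.
  by apply: eq_bigr => k _; rewrite -mulrA -exprS.
have -> : qfact q N = qprod N q 1 by apply: eq_bigr => k _; rewrite mul1r.
by rewrite -!mulrA; congr (_ * (_ * _)); rewrite mulrC.
Qed.

End Theta.

(** * Winquist's identity *)

Section Winquist.
Variables (A : comNzRingType) (N : nat) (q : A) (e : int -> A).
Hypothesis qN : q ^+ N.+1 = 0.
Hypothesis e0 : e 0 = 1.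
Hypothesis eD : forall i j, e (i + j) = e i * e j.
Local Notation K := N.+1.
Local Notation sg j := ((-1 : A) ^+ `|j|%N).

(** For c = 0 the exponents at j = 3 n are n (3 n + 1) / 2, Euler's pentagonal numbers. *)
Definition pentagonal_part (c : int) : A :=
  bsum (3 * K)%N (fun j => if (j %% 3)%Z == c then sg j * q ^+ (tri j %/ 3) else 0).

Lemma sgNegz n : sg (Negz n) = - sg (Posz n).
Proof. by rewrite /= exprS mulN1r. Qed.

Lemma pentagonal_part1 : pentagonal_part 1 = 0.
Proof.
rewrite /pentagonal_part /bsum big1 // => n _.
have -> : ((Negz n %% 3)%Z == 1) = ((Posz n %% 3)%Z == 1) by rewrite NegzE; lia.
by case: ifP; rewrite ?addr0 // sgNegz /= mulNr subrr.
Qed.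

Lemma pentagonal_part2 : pentagonal_part 2 = - pentagonal_part 0.
Proof.
rewrite /pentagonal_part /bsum -sumrN; apply: eq_bigr => n _.
have -> : ((Negz n %% 3)%Z == 2) = ((Posz n %% 3)%Z == 0) by rewrite NegzE; lia.
have -> : ((Negz n %% 3)%Z == 0) = ((Posz n %% 3)%Z == 2) by rewrite NegzE; lia.
rewrite sgNegz /= opprD addrC.
by do 2!case: ifP => _; rewrite ?oppr0 ?mulNr ?opprK.
Qed.

Lemma sum_ord3 (F : nat -> A) n :
  \sum_(k < (3 * n)%N) F k = \sum_(k < n) (F (3 * k)%N + F (3 * k).+1%N + F (3 * k).+2%N).
Proof.
elim: n => [|n IH]; first by rewrite !big_ord0.
by rewrite mulnS -[(3 + _)%N]/((3 * n).+3) !big_ord_recr /= IH !addrA.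
Qed.

Lemma prod_ord3 (F : nat -> A) n :
  \prod_(k < (3 * n)%N) F k = \prod_(k < n) (F (3 * k)%N * F (3 * k).+1%N * F (3 * k).+2%N).
Proof.
elim: n => [|n IH]; first by rewrite !big_ord0.
by rewrite mulnS -[(3 + _)%N]/((3 * n).+3) !big_ord_recr /= IH !mulrA.
Qed.

(** Euler's pentagonal number theorem: the triple product in base q^3 at q^2 and q, whose three
    products sort the factors 1 - q^k by k modulo 3. *)
Lemma pentagonal_part0 : pentagonal_part 0 = qprod N q 1.
Proof.
have q3N : (q ^+ 3) ^+ N.+1 = 0 by rewrite -exprM (expr_nil qN) //; lia.
have := @triple_product A N (q ^+ 3) q3N (q ^+ 2) q (esym (exprSr q 2)).
have -> : bilateral (q ^+ 2) q N.+1 = 0.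
  by rewrite /bilateral -exprM -mulrA -exprD (expr_nil qN) ?mulr0 // !binS2; lia.
rewrite addr0.
have -> : bsum N.+1 (bilateral (q ^+ 2) q) = pentagonal_part 0.
  pose f j : A := if (j %% 3)%Z == 0 then sg j * q ^+ (tri j %/ 3) else 0.
  transitivity (\sum_(k < (3 * K)%N) (f (Posz k) + f (Negz k))); last by [].
  rewrite (sum_ord3 (fun k => f (Posz k) + f (Negz k))); apply: eq_bigr => n _.
  rewrite /f.
  have m1 k (b : bool) : b = false -> (if b then k else 0 : A) = 0 by move=> ->.
  have m2 k (b : bool) : b = true -> (if b then k else 0 : A) = k by move=> ->.
  rewrite (m2 _ ((Posz (3 * n) %% 3)%Z == 0)); last by lia.
  rewrite (m1 _ ((Negz (3 * n) %% 3)%Z == 0)); last by lia.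
  rewrite (m1 _ ((Posz (3 * n).+1 %% 3)%Z == 0)); last by lia.
  rewrite (m1 _ ((Negz (3 * n).+1 %% 3)%Z == 0)); last by lia.
  rewrite (m1 _ ((Posz (3 * n).+2 %% 3)%Z == 0)); last by lia.
  rewrite (m2 _ ((Negz (3 * n).+2 %% 3)%Z == 0)); last by lia.
  rewrite !addr0 !add0r /bilateral.
  have t1 := tri_double (Posz (3 * n)); have t2 := tri_double (Posz (3 * n).+2).
  have t3 := tri_double (Posz n); have t4 := tri_double (Posz n.+1).
  rewrite /tri in t1 t2 t3 t4 *.
  have bn : ('C(n.+1, 2) = 'C(n, 2) + n)%N by apply: binS2.
  have sg3 m : (-1 : A) ^+ (3 * m) = (-1) ^+ m by rewrite exprM; congr (_ ^+ _); ring.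
  congr (_ + _); rewrite -mulrA -exprM -exprD.
    rewrite (_ : sg (Posz (3 * n)%N) = (-1) ^+ n); last exact: sg3.
    by congr (_ * _ ^+ _); nia.
  rewrite (_ : sg (Negz (3 * n).+2) = (-1) ^+ n.+1); last by rewrite -sg3 mulnS.
  by congr (_ * _ ^+ _); nia.
move=> <-.
transitivity (\prod_(k < (3 * N.+1)%N) (1 - q ^+ k.+1)).
  rewrite (prod_ord3 (fun k => 1 - q ^+ k.+1)) 2!big_split /=.
  have -> : qfact (q ^+ 3) N = \prod_(k < N.+1) (1 - (q ^+ 3) ^+ k.+1).
    by rewrite big_ord_recr /= q3N subr0 mulr1.
  rewrite [LHS]mulrC [X in _ * X]mulrC mulrA.
  congr (_ * _ * _); apply: eq_bigr => k _.
  - by rewrite -exprM -exprS.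
  - by rewrite -exprM -exprD.
  - by rewrite -exprM mulnS.
have -> : (3 * N.+1 = N + (2 * N + 3))%N by lia.
rewrite big_split_ord /= [X in _ * X]big1 ?mulr1 => [|k _].
  by apply: eq_bigr => k _; rewrite mul1r.
by rewrite (expr_nil qN) ?subr0 // ltnS leq_addr.
Qed.

End Winquist.

Lemma tri_mod j : (tri j %% 3 = ((j %% 3)%Z == 1))%N.
Proof.
have := tri_double j; have : j = 3 * (j %/ 3)%Z + (j %% 3)%Z by lia.
set t := (j %/ 3)%Z; have : (0 <= (j %% 3)%Z < 3) by lia.
move: (j %% 3)%Z => r hr ->.
have [->|[->|->]] : r = 0 \/ r = 1 \/ r = 2 by lia.
- rewrite [X in _ = X -> _](_ : _ = 3 * (3 * (t * t) + t)); [lia | ring].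
- rewrite [X in _ = X -> _](_ : _ = 9 * (t * t + t) + 2); [lia | ring].
- rewrite [X in _ = X -> _](_ : _ = 3 * (3 * (t * t) + 5 * t + 2)); [lia | ring].
Qed.

Lemma tri_ge j n : (j < - n%:Z) || (n%:Z <= j) -> (n <= tri j)%N.
Proof. by case: j => k; rewrite /tri binS2 ?NegzE; lia. Qed.

(* Winquist's change of variables: 2 x + 1 undergoes an orthogonal map scaled by
   the square root of 3. *)
Lemma tri_winquist (x1 x2 x3 x4 : int) :
  (tri (x1 + x3 + x4 + 1)%R + tri (x2 + x3 - x4)%R + tri (x1 + x2 - x3)%R +
   tri (x1 - x2 - x4 - 1)%R = 3 * (tri x1 + tri x2 + tri x3 + tri x4) + 1)%N.
Proof.
have := tri_double x1; have := tri_double x2; have := tri_double x3; have := tri_double x4.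
have := tri_double (x1 + x3 + x4 + 1); have := tri_double (x2 + x3 - x4).
have := tri_double (x1 + x2 - x3); have := tri_double (x1 - x2 - x4 - 1).
have : (x1 + x3 + x4 + 1) * (x1 + x3 + x4 + 1 + 1) + (x2 + x3 - x4) * (x2 + x3 - x4 + 1)
  + (x1 + x2 - x3) * (x1 + x2 - x3 + 1) + (x1 - x2 - x4 - 1) * (x1 - x2 - x4 - 1 + 1) =
  3 * (x1 * (x1 + 1) + x2 * (x2 + 1) + x3 * (x3 + 1) + x4 * (x4 + 1)) + 2 by ring.
move: (tri _) (tri _) (tri _) (tri _) (tri _) (tri _) (tri _) (tri _) => t1 t2 t3 t4 t5 t6 t7 t8.
move: ((x1 + x3 + x4 + 1) * _) ((x2 + x3 - x4) * _) ((x1 + x2 - x3) * _)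
  ((x1 - x2 - x4 - 1) * _) (x1 * _) (x2 * _) (x3 * _) (x4 * _); lia.
Qed.

Lemma mem_pairs (I J : eqType) (r : seq I) (s : seq J) x y :
  ((x, y) \in [seq (i, j) | i <- r, j <- s]) = (x \in r) && (y \in s).
Proof.
apply/allpairsP/andP => [[[i j] /= [ir js [-> ->]]]//|[xr ys]].
by exists (x, y).
Qed.

Lemma uniq_pairs (I J : eqType) (r : seq I) (s : seq J) :
  uniq r -> uniq s -> uniq [seq (i, j) | i <- r, j <- s].
Proof. by move=> ur us; apply: allpairs_uniq => // -[? ?] [? ?] _ _ [-> ->]. Qed.

Lemma mul_sum_pairs (A : comNzRingType) (I J : Type) (r : seq I) (s : seq J)
    (f : I -> A) (g : J -> A) :
  (\sum_(i <- r) f i) * (\sum_(j <- s) g j) =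
  \sum_(p <- [seq (i, j) | i <- r, j <- s]) f p.1 * g p.2.
Proof. by rewrite big_allpairs big_distrlr. Qed.

Section Winquist2.
Variables (A : comNzRingType) (N : nat) (q : A) (e : int -> A).
Hypothesis qN : q ^+ N.+1 = 0.
Hypothesis e0 : e 0 = 1.
Hypothesis eD : forall i j, e (i + j) = e i * e j.
Local Notation K := N.+1.
Local Notation sg j := ((-1 : A) ^+ absz j).
Local Notation pent := (pentagonal_part N q).

Definition chi3 (c : int) : A := if c == 0 then 1 else if c == 2 then -1 else 0.

Lemma pentagonal_partE c : 0 <= c < 3 -> pent c = chi3 c * qprod N q 1.
Proof.
move=> hc; have [->|[->|->]] : c = 0 \/ c = 1 \/ c = 2 by lia.
- by rewrite pentagonal_part0 // mul1r.
- by rewrite pentagonal_part1 mul0r.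
- by rewrite pentagonal_part2 pentagonal_part0 // mulN1r.
Qed.

(** Given s and t, the congruences of [winquist_term] fix u and w modulo 3; summing over u and w
    leaves this weight. *)
Definition kappa (s t : int) : A := chi3 ((s + t + 2) %% 3)%Z * chi3 ((s - t + 1) %% 3)%Z.

Variables a b : int.

(* The two congruences say that (s, t, u, w) is in the image of the change of
   variables of tri_winquist. *)
Definition winquist_term (p : (int * int) * (int * int)) : A :=
  let: ((s, t), (u, w)) := p in
  if (((s + u + w) %% 3)%Z == 0) && (((t + u - w - 1) %% 3)%Z == 0) then
    sg s * sg t * sg u * sg w * e (a * (s - 1) + b * t) *
    q ^+ ((tri s + tri t + tri u + tri w - 1) %/ 3)
  else 0.

Lemma winquist_inner s t :
  bsum (3 * K)%N (fun u => bsum (3 * K)%N (fun w => winquist_term ((s, t), (u, w)))) =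
  sg s * sg t * e (a * (s - 1) + b * t) * q ^+ (tri s %/ 3 + tri t %/ 3) *
  (kappa s t * (qprod N q 1 * qprod N q 1)).
Proof.
(* When s and t are both 1 modulo 3, so are u and w, and the four quotients by 3 fall short of the
   exponent by one; but the terms cancel under u -> - 1 - u. *)
have [/andP[/eqP s1 /eqP t1]|st1] := boolP (((s %% 3)%Z == 1) && ((t %% 3)%Z == 1)).
  rewrite /kappa (_ : ((s + t + 2) %% 3)%Z = 1); last by lia.
  have -> : chi3 1 = 0 by [].
  rewrite !mul0r mulr0 /bsum big1 // => n _.
  have anti w : winquist_term ((s, t), (Negz n, w)) = - winquist_term ((s, t), (Posz n, w)).
    rewrite /winquist_term (_ : ((s + Negz n + w) %% 3 == 0)%Z && ((t + Negz n - w -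
      1) %% 3 == 0)%Z =
      ((s + Posz n + w) %% 3 == 0)%Z && ((t + Posz n - w - 1) %% 3 == 0)%Z); last by
        rewrite NegzE; lia.
    by case: ifP; rewrite ?oppr0 // sgNegz !(mulrN, mulNr).
  rewrite -big_split big1 // => m _; pose f u w := winquist_term ((s, t), (u, w)).
  by rewrite -[LHS]/(f n m + f n (Negz m) + (f (Negz n) m +
    f (Negz n) (Negz m))) /f !anti -opprD subrr.
transitivity (sg s * sg t * e (a * (s - 1) + b * t) * q ^+ (tri s %/ 3 + tri t %/ 3) *
  (pent ((s + t + 2) %% 3)%Z * pent ((s - t + 1) %% 3)%Z)); last first.
  rewrite !pentagonal_partE /kappa; try by lia.
  by ring.
rewrite /pentagonal_part !bsumE big_distrlr mulr_sumr; apply: eq_bigr => u _.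
rewrite bsumE mulr_sumr; apply: eq_bigr => w _.
rewrite /winquist_term.
have -> : (((s + u + w) %% 3)%Z == 0) && (((t + u - w - 1) %% 3)%Z == 0) =
  ((u %% 3)%Z == ((s + t + 2) %% 3)%Z) && ((w %% 3)%Z == ((s - t + 1) %% 3)%Z) by lia.
case: eqP => [u1|_] /=; last by rewrite mul0r mulr0.
case: eqP => [w1|_] /=; last by rewrite !mulr0.
have := tri_mod s; have := tri_mod t; have := tri_mod u; have := tri_mod w => tw tu tt ts.
rewrite (_ : ((tri s + tri t + tri u + tri w - 1) %/ 3 =
  (tri s %/ 3 + tri t %/ 3) + tri u %/ 3 + tri w %/ 3)%N).
  by rewrite !exprD; ring.
by move: (tri s) (tri t) (tri u) (tri w) tw tu tt ts => ? ? ? ?; lia.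
Qed.

Local Notation th c := (bsum K (fun j => sg j * e (c * j) * q ^+ tri j)).

(** In the new variables the exponentials involve s and t only, so the sums over u and w become
    pentagonal series. *)
Lemma winquist : th a * th b * (th (a + b) * th (a - b)) =
  qprod N q 1 * qprod N q 1 *
  bsum (3 * K)%N (fun s => bsum (3 * K)%N (fun t =>
    kappa s t * sg s * sg t * e (a * (s - 1) + b * t) * q ^+ (tri s %/ 3 + tri t %/ 3))).
Proof.
pose h (p : (int * int) * (int * int)) := let: ((x1, x2), (x3, x4)) := p in
  ((x1 + x3 + x4 + 1, x2 + x3 - x4), (x1 + x2 - x3, x1 - x2 - x4 - 1)).
pose box k := [seq (p, r) | p <- [seq (i, j) | i <- ibox k, j <- ibox k],
                            r <- [seq (i, j) | i <- ibox k, j <- ibox k]].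
have ubox k : uniq (box k) by rewrite !uniq_pairs ?uniq_ibox.
have hinj : injective h.
  move=> [[x1 x2] [x3 x4]] [[y1 y2] [y3 y4]] [h1 h2 h3 h4].
  by congr (_, _, (_, _)); lia.
transitivity (\sum_(p <- box K) winquist_term (h p)).
  rewrite !bsumE !mul_sum_pairs; apply: eq_bigr => -[[x1 x2] [x3 x4]] _ /=.
  rewrite (_ : _ && _ = true); last by lia.
  rewrite tri_winquist addnK mulKn // !exprD.
  have -> : e (a * (x1 + x3 + x4 + 1 - 1) + b * (x2 + x3 - x4)) =
    e (a * x1) * e (b * x2) * (e ((a + b) * x3) * e ((a - b) * x4)).
    by rewrite -!eD; congr e; ring.
  have -> : sg (x1 + x3 + x4 + 1)%R * sg (x2 + x3 - x4)%R * sg (x1 + x2 - x3)%R * sg (x1 - x2 -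
    x4 - 1)%R =
     sg x1 * sg x2 * sg x3 * sg x4.
    by rewrite -!exprD -signr_odd -[RHS]signr_odd; congr (_ ^+ nat_of_bool _); lia.
  ring.
(* The box of size 3 K contains the image of the box of size K. Its other points either violate a
   congruence or come from outside the smaller box, where some [tri] is at least K and the power of
   q vanishes. *)
transitivity (\sum_(p <- box (3 * K)%N) winquist_term p).
  apply: sum_reindex => // [p|[[s t] [u w]]].
    case/mapP => -[[x1 x2] [x3 x4]]; rewrite !mem_pairs !mem_ibox => hx ->.
    by rewrite !mem_pairs !mem_ibox; lia.
  move=> _ hn; rewrite /winquist_term; case: ifP => // /andP[/eqP c1 /eqP c2].
  pose x1 := ((s + u + w) %/ 3)%Z; pose x2 := ((t + u - w - 1) %/ 3)%Z.
  pose x3 := ((s + t - u - 1) %/ 3)%Z; pose x4 := ((s - t - w - 2) %/ 3)%Z.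
  have hE : ((s, t), (u, w)) = h ((x1, x2), (x3, x4)).
    by rewrite /h /x1 /x2 /x3 /x4; congr (_, _, (_, _)); lia.
  move: hE hn => [-> -> -> ->] hn.
  rewrite tri_winquist addnK mulKn // (expr_nil qN) ?mulr0 //.
  have {hn} : ((x1, x2), (x3, x4)) \notin box K.
    by apply: contraNN hn => hb; apply/mapP; exists ((x1, x2), (x3, x4)).
  rewrite !mem_pairs !mem_ibox => hx.
  have h1 := @tri_ge x1 K; have h2 := @tri_ge x2 K.
  have h3 := @tri_ge x3 K; have h4 := @tri_ge x4 K.
  by lia.
rewrite !big_allpairs bsumE mulr_sumr; apply: eq_bigr => s _.
rewrite bsumE mulr_sumr; apply: eq_bigr => t _; rewrite big_allpairs.
transitivity (bsum (3 * K)%N (fun u => bsum (3 * K)%N (fun w => winquist_term ((s, t), (u, w))))).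
  by rewrite bsumE; apply: eq_bigr => u _; rewrite bsumE.
by rewrite winquist_inner; ring.
Qed.

End Winquist2.

(** * Roots of the crank polynomials *)

Local Notation trunc N := (in_qpoly 'X^(S N)).

Lemma truncP (R : comNzRingType) N (p r : {poly R}) n :
  trunc N p = trunc N r -> (n <= N)%N -> p`_n = r`_n.
Proof.
move=> /(congr1 val) /=; rewrite !mk_monic_Xn -[N.+1.-1.+1]/(N.+1) => h nN.
have m : 'X^(N.+1) \is @monic R by apply: monicXn.
rewrite (Pdiv.RingMonic.rdivp_eq m p) (Pdiv.RingMonic.rdivp_eq m r) h.
by rewrite !coefD !coefMXn ltnS nN.
Qed.

Lemma trunc_nil (R : comNzRingType) N : trunc N ('X : {poly R}) ^+ N.+1 = 0.
Proof.
rewrite -rmorphXn /=; apply: val_inj => /=.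
by rewrite mk_monic_Xn -[N.+1.-1.+1]/(N.+1) Pdiv.RingMonic.rmodpp ?monicXn.
Qed.

Section Morphism.
Variables (A B : comNzRingType) (f : {rmorphism A -> B}) (N : nat) (q : A).

Lemma rmorph_iv k : f (iv N q k) = iv N (f q) k.
Proof. by rewrite /iv rmorph_sum; apply: eq_bigr => j _; rewrite rmorphXn. Qed.

Lemma rmorph_iqf n : f (iqf N q n) = iqf N (f q) n.
Proof. by rewrite /iqf rmorph_prod; apply: eq_bigr => j _; rewrite rmorph_iv. Qed.

Lemma rmorph_rect n k : f (rect N q n k) = rect N (f q) n k.
Proof. by rewrite /rect !rmorphM rmorphXn /= !rmorph_iqf. Qed.

Lemma rmorph_crank_row m : f (crank_row N q m) = crank_row N (f q) m.
Proof.
rewrite /crank_row rmorph_sum; apply: eq_bigr => n _.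
by rewrite rmorphM rmorph_rect rmorphB rmorph1.
Qed.

End Morphism.

Definition crank_entry (N n k : nat) : int :=
  ((1 - 'X) * rect N ('X : {poly int}) n k)`_N.

Definition crank_count (N m : nat) : int :=
  (crank_row N ('X : {poly int}) m)`_N.

Lemma nonneg_coef N (p : {poly int}) :
  nonneg (trunc N 'X) (trunc N p) -> 0 <= p`_N.
Proof.
suff h x : nonneg (trunc N 'X) x ->
    exists2 r : {poly int}, x = trunc N r & forall i, 0 <= r`_i.
  by case/h => r /truncP -> //; apply.
elim=> {x} [|||x y _ [r -> r0] _ [s -> s0]|x y _ [r -> r0] _ [s -> s0]].
- by exists 0; rewrite ?rmorph0 // => i; rewrite coef0.
- by exists 1; rewrite ?rmorph1 // => i; rewrite coef1 ler0n.
- by exists 'X => // i; rewrite coefX ler0n.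
- by exists (r + s); rewrite ?rmorphD // => i; rewrite coefD addr_ge0.
- exists (r * s); rewrite ?rmorphM // => i; rewrite coefM.
  by apply: sumr_ge0 => j _; apply: mulr_ge0.
Qed.

Lemma rectC (A : comNzRingType) N (q : A) n k : rect N q n k = rect N q k n.
Proof. by rewrite /rect mulrAC [(n * k)%N]mulnC [(n + k)%N]addnC. Qed.

Lemma crank_entryC N n k : crank_entry N n k = crank_entry N k n.
Proof. by rewrite /crank_entry rectC. Qed.

Lemma crank_entry_nil N n k : (N < n + k + n * k)%N -> crank_entry N n k = 0.
Proof.
move=> h; rewrite /crank_entry /rect -!mulrA [(1 - 'X) * _]mulrCA.
by rewrite [LHS]coefXnM h.
Qed.

Lemma crank_countE N m : crank_count N m = \sum_(n < N.+1) crank_entry N n (n + m).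
Proof. by rewrite /crank_count /crank_row coef_sum. Qed.

Lemma crank_count_nil N m : (N < m)%N -> crank_count N m = 0.
Proof.
by move=> h; rewrite crank_countE big1 // => n _; rewrite crank_entry_nil //; lia.
Qed.

(** The polynomial z^N crank_N(z), see [crankE]; indices beyond N contribute nothing because [rect]
    carries q^(n + k + n k). *)
Definition crank_poly (N : nat) : {poly int} :=
  \sum_(n < N.+1) \sum_(k < N.+1) crank_entry N n k *: 'X^(N + k - n).

Lemma coef_crank_poly N i : (crank_poly N)`_i = crank_count N `|i%:Z - N%:Z|%N.
Proof.
rewrite /crank_poly coef_sum; under eq_bigr do rewrite coef_sum.
have cE n k : (n <= N)%N -> (crank_entry N n k *: 'X^(N + k - n) : {poly int})`_i =
    if (n + i == N + k)%N then crank_entry N n k else 0.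
  move=> nN; rewrite coefZ coefXn (_ : (i == N + k - n)%N = (n + i == N + k)%N); last by lia.
  by case: eqP; rewrite ?mulr1 ?mulr0.
have [Ni|iN] := leqP N i.
  rewrite (_ : `|_|%N = (i - N)%N) ?crank_countE; last by lia.
  apply: eq_bigr => n _; have nN : (n <= N)%N by rewrite -ltnS.
  have [h|h] := ltnP (n + (i - N))%N N.+1.
    rewrite (bigD1 (Ordinal h)) //= cE // (_ : (_ == _)); last by lia.
    rewrite big1 ?addr0 // => k; rewrite -val_eqE /= => kn.
    by rewrite cE // (_ : (_ == _) = false) //; lia.
  rewrite crank_entry_nil; last by lia.
  rewrite big1 // => k _; rewrite cE // (_ : (_ == _) = false) //.
  by have := ltn_ord k; lia.
rewrite (_ : `|_|%N = (N - i)%N) ?crank_countE; last by lia.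
rewrite exchange_big; apply: eq_bigr => k _.
have [h|h] := ltnP (k + (N - i))%N N.+1.
  rewrite (bigD1 (Ordinal h)) //= cE // (_ : (_ == _)); last by lia.
  rewrite crank_entryC big1 ?addr0 // => n; rewrite -val_eqE /= => kn.
  have nN : (n <= N)%N by rewrite -ltnS.
  by rewrite cE // (_ : (_ == _) = false) //; lia.
rewrite crank_entry_nil; last by lia.
rewrite big1 // => n _; have nN : (n <= N)%N by rewrite -ltnS.
by rewrite cE // (_ : (_ == _) = false) //; lia.
Qed.

Section CrankField.
Variables (F : fieldType) (N : nat) (z : F).
Hypothesis z0 : z != 0.
Local Notation ev c := (trunc N (c%:P : {poly F})).

Lemma trunc_crank_prod :
  trunc N (crank_prod N z) * (qprod N (trunc N 'X) (ev z) * qprod N (trunc N 'X) (ev z^-1)) =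
  qprod N (trunc N 'X) 1.
Proof.
have g k c : (0 < k)%N -> trunc N (geom N k c) * (1 - ev c * trunc N 'X ^+ k) = 1.
  move=> k0; have := congr1 (trunc N) (geomE N k c).
  rewrite rmorphM !rmorphB rmorph1 /= -!mul_polyC !rmorphM /= !rmorphXn /=.
  by rewrite (expr_nil (@trunc_nil F N) (leq_pmulr _ k0)) mulr0 subr0 mulrC.
have aux (A : comNzRingType) (a g1 h1 g2 h2 : A) :
    g1 * h1 = 1 -> g2 * h2 = 1 -> a * g1 * g2 * (h1 * h2) = a.
  by move=> e1 e2; rewrite mulrACA e2 mulr1 -mulrA e1 mulr1.
rewrite /crank_prod big_add1 /= big_mkord rmorph_prod /= /qprod -!big_split /=.
apply: eq_bigr => k _; rewrite !rmorphM rmorphB rmorph1 rmorphXn /= mul1r.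
by apply: aux; apply: g.
Qed.

Lemma qprod_unit c : exists u, qprod N (trunc N 'X) (ev c) * u = 1.
Proof.
exists (\prod_(k < N) trunc N (geom N k.+1 c)); rewrite -big_split big1 //= => k _.
have := congr1 (trunc N) (geomE N k.+1 c).
rewrite rmorphM !rmorphB rmorph1 /= -!mul_polyC !rmorphM /= !rmorphXn /=.
by rewrite (expr_nil (@trunc_nil F N) (leq_pmulr _ (ltn0Sn k))) mulr0 subr0.
Qed.

Lemma crankE : crank N z = (map_poly intr (crank_poly N)).[z] / z ^+ N.
Proof.
have := @crank_expansion _ N (trunc N 'X) (@trunc_nil F N) (ev z) (ev z^-1).
rewrite -rmorphM -polyCM mulfV // polyC1 rmorph1 => /(_ erefl).
rewrite -trunc_crank_prod.
have [u hu] := qprod_unit z; have [v hv] := qprod_unit z^-1.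
rewrite mulrC [RHS]mulrC => h.
have {h} := @mul_inv_inj _ _ (u * v) _ _ _ h.
rewrite mulrACA hu hv mul1r => /(_ erefl) h.
have {h} : trunc N (\sum_(n < N.+1) \sum_(k < N.+1) (z ^+ k * z ^- n) *:
    ((1 - 'X) * rect N 'X n k)) = trunc N (crank_prod N z).
  rewrite -h rmorph_sum; apply: eq_bigr => n _; rewrite rmorph_sum; apply: eq_bigr => k _.
  rewrite -mul_polyC rmorphM /= [trunc N ((1 - 'X) * _)]rmorphM /= rmorph_rect /=.
  by rewrite -exprVn polyCM !polyC_exp rmorphM !rmorphXn rmorphB rmorph1.
move/truncP => /(_ N (leqnn N)) h; rewrite /crank -h.
rewrite coef_sum /crank_poly rmorph_sum /= horner_sum mulr_suml.
apply: eq_bigr => n _; rewrite coef_sum rmorph_sum /= horner_sum mulr_suml.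
apply: eq_bigr => k _; rewrite coefZ map_polyZ map_polyXn hornerZ hornerXn mulrC -mulrA.
congr (_ * _).
  rewrite /crank_entry -coef_map rmorphM rmorphB rmorph1 /= rmorph_rect /= map_polyX.
  by [].
have nN : (n <= N)%N by rewrite -ltnS.
apply/eqP; rewrite eqr_div ?expf_neq0 // -!exprD subnK; first by rewrite addnC.
exact: leq_trans nN (leq_addr _ _).
Qed.

End CrankField.

Lemma prod_unity_roots (F : fieldType) (l : nat) (y : F) :
  odd l -> l.-primitive_root y ->
  \prod_(j < l) (1 - (y ^+ j)%:P * 'X) = 1 - 'X^l :> {poly F}.
Proof.
move=> lo yp; have l0 : (0 < l)%N by apply: odd_gt0.
have yl := prim_expr_order yp.
pose v := y ^+ l.-1; have yv : y * v = 1 by rewrite -exprS prednK.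
have vp : l.-primitive_root v.
  by rewrite prim_root_exp_coprime // coprime_sym -{1}(prednK l0) coprimeSn.
have := factor_Xn_sub_1 vp; rewrite big_mkord => vE.
have -> : 1 - 'X^l = - ('X^l - 1) :> {poly F} by rewrite opprB.
have hj j : 1 - (y ^+ j)%:P * 'X = - (y ^+ j)%:P * ('X - (v ^+ j)%:P) :> {poly F}.
  rewrite mulrBr !mulNr opprK -polyCM -exprMn yv expr1n polyC1.
  by rewrite addrC.
rewrite (eq_bigr _ (fun (j : 'I_l) _ => hj j)) big_split /= vE -[RHS]mulN1r; congr (_ * _).
rewrite prodrN card_ord -signr_odd lo expr1 -rmorph_prod /= -expr_sum mulN1r.
rewrite -(big_mkord xpredT id) bin2_sum bin2odd // exprM yl expr1n.
by rewrite polyC1.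
Qed.

Section Avoid.
Variables (F : fieldType) (N : nat).
Local Notation ev c := (trunc N (c%:P : {poly F})).
Local Notation q := (trunc N ('X : {poly F})).

(** Stated through some lift, which is free to have terms beyond N. *)
Definition avoids (l r : nat) (x : {poly %/ ('X^(N.+1) : {poly F})}) : Prop :=
  exists2 p, x = trunc N p & forall n, (n %% l = r)%N -> p`_n = 0.

Lemma avoids_sum l r I (s : seq I) f :
  (forall i, avoids l r (f i)) -> avoids l r (\sum_(i <- s) f i).
Proof.
move=> hf; elim/big_rec: _ => [|i x _ [p -> hp]]; first by exists 0; rewrite ?rmorph0 // => n;
  rewrite coef0.
by have [p' -> hp'] := hf i; exists (p' + p); rewrite ?rmorphD // => n h;
  rewrite coefD hp' ?hp ?addr0.
Qed.

(* Exponents are invariant under t -> - 1 - t, which is Posz n <-> Negz n. *)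
Lemma avoids_bsum l r K K' (G : int -> int -> F) (E : int -> int -> nat) :
  (forall s n, E s (Negz n) = E s (Posz n)) ->
  (forall s n, (E s (Posz n) %% l = r)%N -> G s (Negz n) = - G s (Posz n)) ->
  avoids l r (bsum K (fun s => bsum K' (fun t => ev (G s t) * q ^+ E s t))).
Proof.
move=> hE hG; rewrite bsumE; apply: avoids_sum => s; apply: avoids_sum => n.
exists ((G s (Posz n))%:P * 'X^(E s (Posz n)) + (G s (Negz n))%:P * 'X^(E s (Negz n))).
  by rewrite rmorphD !rmorphM /= !rmorphXn.
move=> k hk; rewrite hE coefD !mul_polyC !coefZ coefXn.
have [kE|_] := eqVneq k; last by rewrite !mulr0 addr0.
by rewrite hG -?kE // mulNr subrr.
Qed.

Lemma avoids_mul l r x (w : {poly F}) : (0 < l)%N -> avoids l r x ->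
  (forall n, ~~ (l %| n)%N -> w`_n = 0) -> avoids l r (x * trunc N w).
Proof.
move=> l0 [p -> hp] hw; exists (p * w); first by rewrite rmorphM.
move=> n hn; rewrite coefM big1 // => i _.
have [ln|ln] := boolP (l %| n - i)%N; last by rewrite hw ?mulr0.
have iN : (i <= n)%N by rewrite -ltnS.
by move: ln; rewrite -eqn_mod_dvd // => /eqP ni; rewrite hp ?mul0r // -ni.
Qed.

Lemma avoids_coef l r (p : {poly F}) : avoids l r (trunc N p) -> (N %% l = r)%N -> p`_N = 0.
Proof. by case=> s /truncP -> // hs /hs. Qed.

(** The inverse of (q^L; q^L) is again a series in q^L, so multiplying by it does not mix the
    classes of exponents modulo l. *)
Lemma vanish_coef l r L c (p : {poly F}) x : (0 < l)%N -> (l %| L)%N -> (0 < L)%N -> c != 0 ->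
  avoids l r x -> (N %% l = r)%N ->
  trunc N p * ev c * qfact (q ^+ L) N = x -> p`_N = 0.
Proof.
move=> l0 lL L0 c0 ax Nr hx.
have qLN : (q ^+ L) ^+ N.+1 = 0 by rewrite exprAC trunc_nil expr0n (gtn_eqF L0).
pose v := iqf N ('X : {poly F}) N \Po 'X^L.
have vE : trunc N v = iqf N (q ^+ L) N.
  by rewrite /v rmorph_iqf /= comp_polyX rmorph_iqf /= rmorphXn.
have {hx} : trunc N (p * c%:P) = x * trunc N v.
  by rewrite vE -hx -[RHS]mulrA qfact_iqf // mulr1 rmorphM.
have : avoids l r (x * trunc N v).
  apply: avoids_mul => // n ln; rewrite coef_comp_poly_Xn //.
  by case: ifP => // Ln; rewrite (dvdn_trans lL Ln) in ln.
move=> av hx; rewrite -hx in av; have := avoids_coef av Nr.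
by rewrite coefMC => /eqP; rewrite mulf_eq0 (negbTE c0) orbF => /eqP.
Qed.

Lemma bsum_mul K K' (f g : int -> {poly %/ ('X^(N.+1) : {poly F})}) :
  bsum K f * bsum K' g = bsum K (fun s => bsum K' (fun t => f s * g t)).
Proof.
rewrite !bsumE big_distrlr; apply: eq_bigr => s _.
by rewrite bsumE.
Qed.

Lemma eq_bsum2 K K' (f g : int -> int -> {poly %/ ('X^(N.+1) : {poly F})}) :
  (forall s t, f s t = g s t) ->
  bsum K (fun s => bsum K' (f s)) = bsum K (fun s => bsum K' (g s)).
Proof.
move=> fg; rewrite !bsumE; apply: eq_bigr => s _; rewrite !bsumE.
by apply: eq_bigr => t _.
Qed.

End Avoid.

Lemma chi3_rmorph (A B : comNzRingType) (f : {rmorphism A -> B}) c : f (chi3 A c) = chi3 B c.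
Proof. by rewrite /chi3; do 2?case: ifP; rewrite ?rmorph1 ?rmorph0 ?rmorphN1. Qed.

Lemma kappa_symr (A : comNzRingType) s t : kappa A s (- 1 - t) = kappa A s t.
Proof. by rewrite /kappa mulrC; congr (chi3 _ (_ %% _)%Z * chi3 _ (_ %% _)%Z); ring. Qed.

(** A nonzero weight means that neither u nor w is 1 modulo 3, and then exactly one of s and t is.
    With E the exponent of q, it follows that (2 s + 1)^2 + (2 t + 1)^2 = 24 E + 10, a multiple of
    11 when E is 6 modulo 11. *)
Lemma kappa_nonzero (A : comNzRingType) s t : kappa A s t != 0 ->
  (tri s + tri t = 3 * (tri s %/ 3 + tri t %/ 3) + 1)%N.
Proof.
have := tri_mod s; have := tri_mod t; rewrite /kappa /chi3.
have [c1|c1] := eqVneq ((s + t + 2) %% 3)%Z 1; first by rewrite c1 mul0r eqxx.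
have [c2|c2] := eqVneq ((s - t + 1) %% 3)%Z 1; first by rewrite c2 mulr0 eqxx.
move=> ht hs _; lia.
Qed.

Lemma sq_mod5 (x : int) : (((x %% 5)%Z == 0) && ((x * x %% 5)%Z == 0)) ||
  ((x * x %% 5)%Z == 1) || ((x * x %% 5)%Z == 4).
Proof.
have [k [r [-> hr]]] : exists k r, x = 5 * k + r /\ (0 <= r < 5).
  by exists (x %/ 5)%Z, (x %% 5)%Z; lia.
have -> : (5 * k + r) * (5 * k + r) = 5 * (5 * (k * k) + 2 * (k * r)) + r * r by ring.
have : r = 0 \/ r = 1 \/ r = 2 \/ r = 3 \/ r = 4 by lia.
by do ![case=> [->|]] => [||||->]; lia.
Qed.

Lemma sq_mod7 (x : int) : (((x %% 7)%Z == 0) && ((x * x %% 7)%Z == 0)) ||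
  ((x * x %% 7)%Z == 1) || ((x * x %% 7)%Z == 2) || ((x * x %% 7)%Z == 4).
Proof.
have [k [r [-> hr]]] : exists k r, x = 7 * k + r /\ (0 <= r < 7).
  by exists (x %/ 7)%Z, (x %% 7)%Z; lia.
have -> : (7 * k + r) * (7 * k + r) = 7 * (7 * (k * k) + 2 * (k * r)) + r * r by ring.
have : r = 0 \/ r = 1 \/ r = 2 \/ r = 3 \/ r = 4 \/ r = 5 \/ r = 6 by lia.
by do ![case=> [->|]] => [||||||->]; lia.
Qed.

Lemma sq_mod11 (x : int) : (((x %% 11)%Z == 0) && ((x * x %% 11)%Z == 0)) ||
  ((x * x %% 11)%Z == 1) || ((x * x %% 11)%Z == 3) || ((x * x %% 11)%Z == 4) ||
  ((x * x %% 11)%Z == 5) || ((x * x %% 11)%Z == 9).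
Proof.
have [k [r [-> hr]]] : exists k r, x = 11 * k + r /\ (0 <= r < 11).
  by exists (x %/ 11)%Z, (x %% 11)%Z; lia.
have -> : (11 * k + r) * (11 * k + r) = 11 * (11 * (k * k) + 2 * (k * r)) + r * r by ring.
have : r = 0 \/ r = 1 \/ r = 2 \/ r = 3 \/ r = 4 \/ r = 5 \/ r = 6 \/ r = 7 \/ r = 8 \/ r = 9 \/ r = 10 by lia.
by do ![case=> [->|]] => [||||||||||->]; lia.
Qed.

Lemma tri_sq j : 8 * (tri j)%:Z + 1 = (2 * j + 1) * (2 * j + 1).
Proof. by have := tri_double j => h; transitivity (4 * ((tri j)%:Z * 2) + 1); [lia | rewrite h;
  ring]. Qed.

Section Vanish.
Variables (F : fieldType) (N : nat).
Local Notation ev c := (trunc N (c%:P : {poly F})).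
Local Notation q := (trunc N ('X : {poly F})).

Let qN : q ^+ N.+1 = 0 := @trunc_nil F N.

Lemma qprod_roots l m (y : F) : odd l -> l.-primitive_root y ->
  \prod_(j < l) qprod N (q ^+ m) (ev (y ^+ j)) = qfact (q ^+ (m * l)) N.
Proof.
move=> lo yp; rewrite /qprod exchange_big; apply: eq_bigr => k _.
have h : \prod_(j < l) (1 - (y ^+ j)%:P * 'X^(m * k.+1)) = 1 - 'X^(m * k.+1 * l) :> {poly F}.
  have := congr1 (comp_poly 'X^(m * k.+1)) (prod_unity_roots lo yp).
  rewrite rmorph_prod rmorphB rmorph1 rmorphXn /= comp_polyX -exprM => <-.
  by apply: eq_bigr => j _; rewrite rmorphB rmorph1 rmorphM /= comp_polyC comp_polyX.
have {h} := congr1 (trunc N) h.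
rewrite rmorph_prod rmorphB rmorph1 rmorphXn /= -!exprM mulnAC => <-.
by apply: eq_bigr => j _; rewrite rmorphB rmorph1 rmorphM /= [in RHS](rmorphXn _ _ 'X).
Qed.

Section Powers.
Variable y : F.
Hypothesis y0 : y != 0.
Definition evz (j : int) : {poly %/ ('X^(N.+1) : {poly F})} := ev (y ^ j).

Lemma evz0 : evz 0 = 1.
Proof. by rewrite /evz expr0z rmorph1. Qed.

Lemma evzD i j : evz (i + j) = evz i * evz j.
Proof. by rewrite /evz expfzDr // polyCM rmorphM. Qed.

End Powers.

Lemma expz_root l (y : F) (i j k : int) : y ^+ l = 1 -> y != 0 ->
  i = j + l%:Z * k -> y ^ i = y ^ j.
Proof. by move=> yl y0 ->; rewrite expfzDr // -exprz_exp -exprnP yl exp1rz mulr1. Qed.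

Lemma theta_expz y (x : {poly %/ ('X^(N.+1) : {poly F})}) (a : int) :
  y != 0 -> x ^+ N.+1 = 0 ->
  qprod N x 1 * (qprod N x (ev (y ^ a)) * qprod N x (ev (y ^ (- a)))) * ev (1 - y ^ (- a)) =
  bsum N.+1 (fun j => ev ((-1) ^+ `|j|%N * y ^ (a * j)) * x ^+ tri j).
Proof.
move=> y0 xN; have := @theta _ N (evz y) (evz0 y) (evzD y0) x a xN.
rewrite /evz polyCB rmorphB polyC1 rmorph1 => ->.
rewrite !bsumE; apply: eq_bigr => j _; congr (_ * _).
by rewrite polyCM rmorphM polyC_exp rmorphXn polyCN polyC1 rmorphN1.
Qed.

Lemma sign_Negz n : (-1) ^+ `|Negz n|%N = - (-1) ^+ `|Posz n|%N :> F.
Proof. by rewrite /= exprS mulN1r. Qed.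

Lemma prim_neq0 l (y : F) : l.-primitive_root y -> y != 0.
Proof.
move=> yp; apply/eqP => y0; have := prim_expr_order yp.
by rewrite y0 expr0n (gtn_eqF (prim_order_gt0 yp)) => /esym/eqP; rewrite oner_eq0.
Qed.

Lemma prim_expz_neq1 l (y : F) (j : int) : l.-primitive_root y ->
  (j %% l)%Z != 0 -> 1 - y ^ j != 0.
Proof.
move=> yp jl; have l0 := prim_order_gt0 yp.
rewrite subr_eq0 eq_sym (@expz_root l y j (`|(j %% l)%Z|%N%:Z) (j %/ l)%Z) ?(prim_neq0 yp) ?prim_expr_order //; last first.
  by rewrite {1}(divz_eq j l) gez0_abs ?modz_ge0 ?eqz_nat -?lt0n // mulrC addrC.
rewrite -exprnP -(expr0 y) (eq_prim_root_expr yp) mod0n modn_small ?absz_eq0 //.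
by rewrite -ltz_nat gez0_abs ?modz_ge0 ?ltz_pmod // eqz_nat -lt0n.
Qed.

(* 8 (tri s + tri t) + 2 = (2 s + 1)^2 + (2 t + 1)^2, and - 1 is not a square
   modulo 7. *)
Lemma crank7_vanish (z : F) : 7.-primitive_root z -> (N %% 7 = 5)%N -> crank N z = 0.
Proof.
move=> zp Nr; have z0 := prim_neq0 zp; have z7 := prim_expr_order zp.
(* Up to sign 2 and 3 are the residues modulo 7 other than 0 and 1; [c] collects the extra factors
   of the two theta series. *)
pose c := (1 - z ^ (-2)) * (1 - z ^ (-3)).
have c0 : c != 0 by rewrite mulf_neq0 // (prim_expz_neq1 zp).
pose G s t := (-1) ^+ `|s|%N * z ^ (2 * s) * ((-1) ^+ `|t|%N * z ^ (3 * t)) : F.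
pose E s t := (tri s + tri t)%N.
apply: (@vanish_coef F N 7 5 7 c _ (bsum N.+1 (fun s => bsum N.+1 (fun t => ev (G s t) *
  q ^+ E s t)))) => //.
  apply: avoids_bsum => // s n hE.
  rewrite /G sign_Negz mulNr mulrN; congr (- (_ * (_ * _))).
  (* The indices n and - 1 - n differ by 2 n + 1, here a multiple of 7, so the powers of z agree and
     only the signs differ. *)
  have /expz_root -> // : 3 * Negz n = 3 * Posz n + 7%:Z * - (3 * ((2 * n + 1) %/ 7))%N%:Z.
  have := tri_sq s; have := tri_sq n; have := sq_mod7 (2 * s + 1); have := sq_mod7 (2 * n%:Z + 1).
  rewrite NegzE; set u := _ * _; set v := _ * _.
  by move: hE; rewrite /E => *; lia.
transitivity (bsum N.+1 (fun s => ev ((-1) ^+ `|s|%N * z ^ (2 * s)) * q ^+ tri s) *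
   bsum N.+1 (fun s => ev ((-1) ^+ `|s|%N * z ^ (3 * s)) * q ^+ tri s)); last first.
  by rewrite bsum_mul; apply: eq_bsum2 => s t; rewrite mulrACA -exprD -rmorphM -polyCM.
rewrite -!theta_expz //.
have mE a b : ev (a * b) = ev a * ev b by rewrite polyCM rmorphM.
have := qprod_roots 1 (isT : odd 7) zp; rewrite expr1 mul1n => <-.
have := trunc_crank_prod N z.
have zE (k : int) j : k = j%:Z - 7 -> z ^ k = z ^+ j.
  by move=> kj; rewrite (@expz_root 7 z _ j%:Z (-1)) // kj; lia.
have zV : z^-1 = z ^+ 6 := zE (-1) 6%N erefl.
pose Q j := qprod N q (ev (z ^+ j)).
rewrite -(big_mkord xpredT Q) /index_iota /= !big_cons big_nil.
rewrite /c mE zV !(zE (-2) 5%N) // !(zE (-3) 4%N) // -!exprnP.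
have QE j : qprod N q (ev (z ^+ j)) = Q j by [].
rewrite !(QE 2%N, QE 3%N, QE 4%N, QE 5%N, QE 6%N) {QE}.
have -> : qprod N q 1 = Q 0%N by rewrite /Q expr0 polyC1 rmorph1.
have -> : qprod N q (ev z) = Q 1%N by [].
by move: Q => Q <-; ring.
Qed.

(* The parameters of Winquist's identity are 5, 2, 5 + 2 and 5 - 2, which with
   their opposites are the residues modulo 11 other than 0, 1 and - 1. *)
Lemma crank11_vanish (z : F) : 11.-primitive_root z -> (N %% 11 = 6)%N -> crank N z = 0.
Proof.
move=> zp Nr; have z0 := prim_neq0 zp; have z11 := prim_expr_order zp.
pose c := (1 - z ^ (-5)) * (1 - z ^ (-2)) * ((1 - z ^ (-7)) * (1 - z ^ (-3))).
have c0 : c != 0 by rewrite !mulf_neq0 // (prim_expz_neq1 zp).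
pose G s t := kappa F s t * (-1) ^+ `|s|%N * (-1) ^+ `|t|%N * z ^ (5 * (s - 1) + 2 * t) : F.
pose E s t := (tri s %/ 3 + tri t %/ 3)%N.
apply: (@vanish_coef F N 11 6 11 c _
  (bsum (3 * N.+1)%N (fun s => bsum (3 * N.+1)%N (fun t => ev (G s t) * q ^+ E s t)))) => //.
  apply: avoids_bsum => // s n hE.
  have NE : Negz n = -1 - n%:Z by rewrite NegzE; lia.
  rewrite /G sign_Negz NE kappa_symr -NE.
  have [->|/kappa_nonzero k0] := eqVneq (kappa F s n) 0; first by rewrite !mul0r oppr0.
  rewrite mulrN mulNr; congr (- (_ * _)).
  have /expz_root -> // : 5 * (s - 1) + 2 * Negz n =
      5 * (s - 1) + 2 * Posz n + 11%:Z * - (2 * ((2 * n + 1) %/ 11))%N%:Z.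
  have := tri_sq s; have := tri_sq n; have := sq_mod11 (2 * s + 1); have := sq_mod11 (2 * n%:Z + 1).
  rewrite NegzE; set u := _ * _; set v := _ * _.
  by move: hE k0; rewrite /E => *; lia.
have := winquist qN (evzD z0) 5 2.
have mE a b : ev (a * b) = ev a * ev b by rewrite polyCM rmorphM.
have thE a : bsum N.+1 (fun j => (-1) ^+ `|j|%N * evz z (a * j) * q ^+ tri j) =
    qprod N q 1 * (qprod N q (ev (z ^ a)) * qprod N q (ev (z ^ (- a)))) * ev (1 - z ^ (- a)).
  rewrite theta_expz // !bsumE; apply: eq_bigr => j _; congr (_ * _).
  by rewrite mE polyC_exp rmorphXn polyCN polyC1 rmorphN1.
rewrite !thE.
have chiE k : ev (chi3 F k) = chi3 _ k.
  by rewrite (chi3_rmorph polyC) (chi3_rmorph (trunc N)).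
set X := bsum _ _; set Y := bsum _ _.
have -> : X = Y.
  apply: eq_bsum2 => s t; rewrite /G /E !mE /evz !polyC_exp !rmorphXn polyCN polyC1 rmorphN1.
  by rewrite /kappa -!chiE.
have := qprod_roots 1 (isT : odd 11) zp; rewrite expr1 mul1n => <-.
have := trunc_crank_prod N z.
have zE (k : int) j : k = j%:Z - 11 -> z ^ k = z ^+ j.
  by move=> kj; rewrite (@expz_root 11 z _ j%:Z (-1)) // kj; lia.
have zV : z^-1 = z ^+ 10 := zE (-1) 10%N erefl.
(* Both sides of Winquist's identity contain the square of (q; q), to be cancelled by that of
   [v]. *)
have [v hv] := qprod_unit N (1 : F).
pose Q j := qprod N q (ev (z ^+ j)).
rewrite -(big_mkord xpredT Q) /index_iota /= !big_cons big_nil.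
have -> : ev c = ev (1 - z ^ (-5)) * ev (1 - z ^ (-2)) * (ev (1 - z ^ (-7)) * ev (1 - z ^ (-3))).
  by rewrite /c !mE.
rewrite zV !(zE (-5) 6%N) // !(zE (-2) 9%N) // !(zE (-7) 4%N) // !(zE (-3) 8%N) //.
rewrite -?exprnP.
have QE j : qprod N q (ev (z ^+ j)) = Q j by [].
rewrite !(QE 5%N, QE 6%N, QE 2%N, QE 9%N, QE 7%N, QE 4%N, QE 3%N, QE 8%N, QE 10%N) {QE}.
have e1 : ev 1 = 1 by rewrite polyC1 rmorph1.
have v1 : qprod N q 1 * v = 1 by move: hv; rewrite e1.
have Q0 : qprod N q 1 = Q 0%N by rewrite /Q expr0 polyC1 rmorph1.
have -> : qprod N q (ev z) = Q 1%N by [].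
rewrite {}Q0 in v1 *; move: Q v1 => Q v1 h1 h2.
have h3 : Q 0%N * Q 0%N * (v * v) = 1 by rewrite mulrACA v1 mulr1.
apply: (@mul_inv_inj _ _ _ _ _ h3); rewrite -h2 -h1; ring.
Qed.

(* Here (1 - z q^k) (1 + z q^k) = 1 - z^2 q^(2 k), so one theta series has base q
   and argument - z, the other base q^2 and argument z^4; and - 2 is not a square
   modulo 5. *)
Lemma crank5_vanish (z : F) : 5.-primitive_root (z ^+ 2) -> (N %% 5 = 4)%N -> crank N z = 0.
Proof.
move=> zp Nr; set y := z ^+ 2 in zp; have y0 := prim_neq0 zp.
have z0 : z != 0 by apply: contra y0 => /eqP z0; rewrite /y z0 expr0n.
have y5 := prim_expr_order zp.
have mz0 : - z != 0 by rewrite oppr_eq0.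
pose c := (1 - (- z) ^ (-1)) * (1 - y ^ (-2)).
have c0 : c != 0.
  rewrite mulf_neq0 // ?(prim_expz_neq1 zp) //.
  apply: contra (prim_expz_neq1 zp (isT : (1 %% 5)%Z != 0)).
  rewrite !subr_eq0 expr1z /y => /eqP h; rewrite -sqrrN.
  by rewrite -[- z]invrK -[(- z)^-1]h invr1 expr1n.
pose G s t := (-1) ^+ `|s|%N * (- z) ^ (1 * s) * ((-1) ^+ `|t|%N * y ^ (2 * t)) : F.
pose E s t := (tri s + 2 * tri t)%N.
(* Here L = 10 because the product over the fifth roots of unity is taken in base q^2. *)
apply: (@vanish_coef F N 5 4 10 c _ (bsum N.+1 (fun s => bsum N.+1 (fun t => ev (G s t) *
  q ^+ E s t)))) => //.
  apply: avoids_bsum => // s n hE.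
  rewrite /G sign_Negz mulNr mulrN; congr (- (_ * (_ * _))).
  have /expz_root -> // : 2 * Negz n = 2 * Posz n + 5%:Z * - (2 * ((2 * n + 1) %/ 5))%N%:Z.
  have := tri_sq s; have := tri_sq n; have := sq_mod5 (2 * s + 1); have := sq_mod5 (2 * n%:Z + 1).
  rewrite NegzE; set u := _ * _; set v := _ * _.
  by move: hE; rewrite /E => *; lia.
have q2N : (q ^+ 2) ^+ N.+1 = 0 by rewrite exprAC qN expr0n.
transitivity (bsum N.+1 (fun s => ev ((-1) ^+ `|s|%N * (- z) ^ (1 * s)) * q ^+ tri s) *
   bsum N.+1 (fun s => ev ((-1) ^+ `|s|%N * y ^ (2 * s)) * (q ^+ 2) ^+ tri s)); last first.
  by rewrite bsum_mul; apply: eq_bsum2 => s t; rewrite mulrACA -exprM -exprD -rmorphM -polyCM.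
rewrite -!theta_expz //.
have := qprod_roots 2 (isT : odd 5) zp; rewrite -[(2 * 5)%N]/10%N => <-.
have := trunc_crank_prod N z.
have qprod_sq a : qprod N (q ^+ 2) (ev (a ^+ 2)) = qprod N q (ev a) * qprod N q (ev (- a)).
  rewrite /qprod -big_split; apply: eq_bigr => i _ /=.
  by rewrite exprAC polyC_exp rmorphXn polyCN rmorphN; ring.
have zE (k : int) j : k = j%:Z - 5 -> y ^ k = y ^+ j.
  by move=> kj; rewrite (@expz_root 5 y _ j%:Z (-1)) // kj; lia.
have yV : y ^+ 4 = z^-1 ^+ 2 by rewrite exprVn; have := zE (-1) 4%N erefl.
have mE a b : ev (a * b) = ev a * ev b by rewrite polyCM rmorphM.
have mV : (- z) ^ (-1) = - z^-1 by rewrite -invrN.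
pose Q j := qprod N (q ^+ 2) (ev (y ^+ j)).
rewrite -(big_mkord xpredT Q) /index_iota /= !big_cons big_nil.
rewrite /c mE mV !(zE (-2) 3%N) // expr1z -!exprnP.
have QE j : qprod N (q ^+ 2) (ev (y ^+ j)) = Q j by [].
rewrite !(QE 2%N, QE 3%N) {QE}.
have -> : qprod N (q ^+ 2) 1 = Q 0%N by rewrite /Q expr0 polyC1 rmorph1.
have -> : Q 4%N = qprod N q (ev z^-1) * qprod N q (ev (- z^-1)) by rewrite /Q yV qprod_sq.
have -> : Q 1%N = qprod N q (ev z) * qprod N q (ev (- z)) by rewrite /Q expr1 qprod_sq.
by move: (qprod N q) Q => P Q <-; ring.
Qed.

End Vanish.

(** * Differences of counts and division by cyclotomic polynomials *)

Section Counts.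
Variable N : nat.
Local Notation M := (crank_count N).
Local Notation q := (trunc N ('X : {poly int})).

Let qN : q ^+ N.+1 = 0 := @trunc_nil int N.

(** For m >= 2 the exponents 1, 2 and m + 1 are distinct and at most n + m + 1, so they cancel in
    every term and no power of q is exceptional: (a) can concern the crank itself. *)
Lemma diff2_nonneg (A : comNzRingType) (x : A) m : x ^+ N.+1 = 0 -> (1 < m)%N ->
  nonneg x (crank_row N x m - crank_row N x m.+2).
Proof.
move=> xN m1; rewrite crank_diff2 //; apply: nonneg_sum => n _; rewrite /rect.
have u : uniq [:: 1; 2; m.+1]%N by rewrite /= !inE; lia.
have a : all (fun k => 0 < k <= (n + m).+1)%N [:: 1; 2; m.+1]%N by rewrite /=; lia.
have := nonneg_iqf_cancel xN u a; rewrite !big_cons big_nil mulr1 expr1 iqfS.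
set e := x ^+ (_ + _)%N; set v := iqf _ _ n; set w := iqf _ _ _; set i := iv _ _ _ => h.
rewrite [X in nonneg x X](_ : _ = e * x ^+ (2 * n) * v *
  ((1 - x) * ((1 - x ^+ 2) * (1 - x ^+ m.+1)) * (w * i))); last by ring.
by apply: nonnegM => //; apply: nonnegM; [apply: nonnegM; exact: nonnegXn | exact: nonneg_iqf].
Qed.

Lemma crank_count_diff2 m : (1 < m)%N -> 0 <= M m - M m.+2.
Proof.
move=> m1; rewrite /crank_count -coefB; apply: nonneg_coef.
by rewrite rmorphB !rmorph_crank_row; apply: diff2_nonneg.
Qed.

Lemma crank_count_ge m (E : {poly int}) :
  nonneg q (crank_row N q m - crank_row N q m.+1 + trunc N E) ->
  - E`_N <= M m - M m.+1.
Proof.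
move=> h; rewrite lerNl -subr_ge0 opprK addrC /crank_count -coefB -coefD.
by apply: nonneg_coef; rewrite rmorphD rmorphB !rmorph_crank_row.
Qed.

Lemma crank_count3 :
  (N == 9)%:Z - (N == 4)%:Z - (N == 8)%:Z - (N == 10)%:Z - (N == 16)%:Z <= M 3 - M 4.
Proof.
have := @crank_count_ge 3 ('X^4 + 'X^8 + 'X^10 + 'X^16 - 'X^9).
rewrite !(rmorphD, rmorphN, rmorphXn) /= => /(_ (diff3_low qN)).
by rewrite !coefE; lia.
Qed.

Lemma crank_count4 : (N == 12)%:Z - (N == 5)%:Z - (N == 9)%:Z - (N == 13)%:Z <= M 4 - M 5.
Proof.
have := @crank_count_ge 4 ('X^5 + 'X^9 + 'X^13 - 'X^12).
rewrite !(rmorphD, rmorphN, rmorphXn) /= => /(_ (diff4_low qN)).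
by rewrite !coefE; lia.
Qed.

Lemma crank_count5 : (N == 17)%:Z - (N == 6)%:Z - (N == 12)%:Z <= M 5 - M 6.
Proof.
have := @crank_count_ge 5 ('X^6 + 'X^12 - 'X^17).
rewrite !(rmorphD, rmorphN, rmorphXn) /= => /(_ (diff5_low qN)).
by rewrite !coefE; lia.
Qed.

Lemma crank_count6 : - (N == 7)%:Z - (N == 13)%:Z <= M 6 - M 7.
Proof.
have := @crank_count_ge 6 ('X^7 + 'X^13).
rewrite !(rmorphD, rmorphXn) /= => /(_ (diff6_low qN)).
by rewrite !coefE; lia.
Qed.

Lemma crank_count7 : - (N == 8)%:Z <= M 7 - M 8.
Proof.
have h0 := @crank_count_ge 7 'X^8; rewrite rmorphXn /= coefXn mulrb in h0.
suff /h0 : nonneg q (crank_row N q 7 - crank_row N q 8 + q ^+ 8) by case: eqP.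
have h : nonneg q (q ^+ 9 + q ^+ 21 * iv N q 2).
  by apply: nonnegD; [|apply: nonnegM]; [exact: nonnegXn..|exact: nonneg_iv].
by have := nonnegD (diff7_low qN) h; congr (nonneg _ _); ring.
Qed.

(** Row 7 pays for the deficits q^9, q^21 and q^27 / (1 - q^2) of row 2; none of the five remaining
    N is 4 modulo 5. *)
Lemma crank_count27 :
  - (N == 3)%:Z - (N == 5)%:Z - (N == 8)%:Z - (N == 15)%:Z - (N == 17)%:Z <=
  (M 2 - M 3) + (M 7 - M 8).
Proof.
(* These powers complete q^21 and q^27 / (1 - q^2) to q^21 / (1 - q^2). *)
have h : nonneg q (q ^+ 23 + q ^+ 25) by apply: nonnegD; exact: nonnegXn.
have {h} := nonnegD (nonnegD (diff2_low qN) (diff7_low qN)) h.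
have i2 : iv N q 2 = 1 + q ^+ 2 + q ^+ 4 + q ^+ 6 * iv N q 2.
  by have h := @ivE _ _ _ qN 2 isT; rewrite {1}h {1}h {1}h; ring.
rewrite [X in nonneg q X](_ : _ = trunc N ((crank_row N 'X 2 - crank_row N 'X 3) +
  (crank_row N 'X 7 - crank_row N 'X 8) + ('X^3 + 'X^5 + 'X^8 + 'X^15 + 'X^17))).
  rewrite /crank_count; move/nonneg_coef; rewrite !(coefD, coefN, coefXn).
  by move: (_`_N) (_`_N) (_`_N) (_`_N) => a b c d; lia.
have rE k : trunc N (crank_row N 'X k) = crank_row N q k by exact: rmorph_crank_row.
rewrite !(rmorphD, rmorphN) /= !rE !rmorphXn /= {2}i2.
by ring.
Qed.

Lemma crank_count8 m : (7 < m)%N ->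
  (N == m + 6)%:Z + (N == m + 8)%:Z + (N == m + 12)%:Z - (N == m.+1)%:Z <= M m - M m.+1.
Proof.
case: m => // m m7.
have := @crank_count_ge m.+1 ('X^(m.+2) - 'X^(m.+1 + 6) - 'X^(m.+1 + 8) - 'X^(m.+1 + 12)).
rewrite !(rmorphD, rmorphN, rmorphXn) /= => h.
have {h}/h : nonneg q (crank_row N q m.+1 - crank_row N q m.+2 +
    (q ^+ m.+2 - q ^+ (m.+1 + 6) - q ^+ (m.+1 + 8) - q ^+ (m.+1 + 12))).
  have h0 : nonneg q (q ^+ m.+1 + q ^+ m.+3) by apply: nonnegD; exact: nonnegXn.
  have := nonnegD (diff_low qN m7) h0; congr (nonneg _ _).
  by rewrite !(exprD _ m.+1) [q ^+ m.+2]exprS [q ^+ m.+3]exprS [q ^+ m.+2]exprS; ring.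
by rewrite !coefE; lia.
Qed.

Lemma crank_countN : (0 < N)%N -> M N = 1.
Proof.
move=> N0; rewrite crank_countE (bigD1 ord0) //= big1 => [|n n0]; last first.
  by rewrite crank_entry_nil //; move: n0; rewrite -val_eqE /= -lt0n; lia.
rewrite addr0 /crank_entry /rect iqf0 mul0n addn0 !add0n mulr1 mulrCA.
rewrite coefXnM ltnn subnn -horner_coef0 hornerM hornerD hornerN hornerX hornerC subr0 mul1r.
rewrite -[X in X = _]/(horner_eval 0 _) rmorph_iqf /iqf big1 // => i _.
rewrite /iv big_ord_recl muln0 expr0 big1 ?addr0 // => j _ /=.
by rewrite /horner_eval hornerX expr0n muln_eq0.
Qed.

(** The absolute value matters for n = 0, where N < l. *)
Definition star_count (l m : nat) : int :=
  M m + (m == `|N%:Z - l%:Z|%N)%:Z - (m == N)%:Z.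

End Counts.

(** Apart from row 2, an exceptional N of row m is m + 1 or m + l, where the modification adds a
    unit to the difference, or lies in another class modulo l. The same holds for l = 7 and l = 11
    in the rows considered there. *)
Lemma star_count5 n m : (2 <= m)%N -> let M := star_count (5 * n + 4) 5 in
  0 <= M m - M m.+1 \/ 0 <= (M m - M m.+1) + (M (m + 5)%N - M (m + 5).+1).
Proof.
set N := (5 * n + 4)%N => m2 /=; rewrite /star_count.
have N0 : (0 < N)%N by lia.
have [->|m2'] := eqVneq m 2%N.
  by right; have := crank_count27 N; move: (crank_count _ _) => ?; rewrite -[(2 + 5)%N]/7%N; lia.
left; have [mN|mN] := eqVneq m N.
  by rewrite mN crank_countN // crank_count_nil //; lia.
have [m3|m3] := eqVneq m 3%N; first by subst m; have := crank_count3 N; lia.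
have [m4|m4] := eqVneq m 4%N; first by subst m; have := crank_count4 N; lia.
have [m5|m5] := eqVneq m 5%N; first by subst m; have := crank_count5 N; lia.
have [m6|m6] := eqVneq m 6%N; first by subst m; have := crank_count6 N; lia.
have [m7|m7] := eqVneq m 7%N; first by subst m; have := crank_count7 N; lia.
have m8 : (7 < m)%N by lia.
by have := crank_count8 N m8; lia.
Qed.

Lemma star_count7 n m : (3 <= m)%N -> let M := star_count (7 * n + 5) 7 in
  0 <= M m - M m.+1.
Proof.
set N := (7 * n + 5)%N => m3 /=; rewrite /star_count.
have N0 : (0 < N)%N by lia.
have [mN|mN] := eqVneq m N.
  by rewrite mN crank_countN // crank_count_nil //; lia.
have [m3'|m3'] := eqVneq m 3%N; first by subst m; have := crank_count3 N; lia.
have [m4|m4] := eqVneq m 4%N; first by subst m; have := crank_count4 N; lia.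
have [m5|m5] := eqVneq m 5%N; first by subst m; have := crank_count5 N; lia.
have [m6|m6] := eqVneq m 6%N; first by subst m; have := crank_count6 N; lia.
have [m7|m7] := eqVneq m 7%N; first by subst m; have := crank_count7 N; lia.
have m8 : (7 < m)%N by lia.
by have := crank_count8 N m8; lia.
Qed.

Lemma star_count11 n m : (5 <= m)%N -> let M := star_count (11 * n + 6) 11 in
  0 <= M m - M m.+1.
Proof.
set N := (11 * n + 6)%N => m5 /=; rewrite /star_count.
have N0 : (0 < N)%N by lia.
have [mN|mN] := eqVneq m N.
  by rewrite mN crank_countN // crank_count_nil //; lia.
have [m5'|m5'] := eqVneq m 5%N; first by subst m; have := crank_count5 N; lia.
have [m6|m6] := eqVneq m 6%N; first by subst m; have := crank_count6 N; lia.
have [m7|m7] := eqVneq m 7%N; first by subst m; have := crank_count7 N; lia.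
have m8 : (7 < m)%N by lia.
by have := crank_count8 N m8; lia.
Qed.

(** Unfolded, f j is a sum of values of D along steps of T; a negative [D m] is taken together with
    the next value [D (m + T)]. *)
Lemma nonneg_recurrence (f : int -> int) (D : nat -> int) (N T B : nat) (h : int) :
  (0 < T)%N -> 0 <= h -> (forall j : int, j < - B%:Z -> f j = 0) ->
  (forall j : int, j <= N%:Z - h -> f j = f (j - T%:Z) + D `|N%:Z - j|%N) ->
  (forall m : nat, h <= m -> 0 <= D m \/ 0 <= D m + D (m + T)%N) ->
  forall j : int, j <= N%:Z - h -> 0 <= f j.
Proof.
move=> T0 h0 fB fE hD j; have [n] : exists n : nat, j < n%:Z - B%:Z.
  by exists (`|j| + B + 1)%N; lia.
have [k] := ubnP n; elim: k n j => // k IH n j nk jn jN.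
have [jB|jB] := ltrP j (- B%:Z); first by rewrite fB.
have h1 : 0 <= f (j - T%:Z) by apply: (IH n.-1); lia.
have h2 : 0 <= f (j - T%:Z - T%:Z) by apply: (IH n.-1); lia.
have e1 := fE (j - T%:Z).
rewrite fE //; case: (hD `|N%:Z - j|%N) => [|d|d]; [by lia|by lia|].
rewrite e1; last by lia.
by rewrite (_ : `|(N%:Z - (j - T%:Z))%R|%N = (`|N%:Z - j| + T)%N); lia.
Qed.

Lemma nonneg_quotient (s l N : nat) (c : nat -> int) (p g : {poly int}) :
  (0 < s)%N -> (0 < l)%N -> odd l ->
  (forall i, p`_i = c `|i%:Z - N%:Z|%N) -> (forall m, (N < m)%N -> c m = 0) ->
  (forall m, (s * l.-1 <= 2 * m)%N -> 0 <= c m - c (m + s)%N \/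
     0 <= (c m - c (m + s)%N) + (c (m + s * l)%N - c (m + s * l + s)%N)) ->
  ('X^s - 1) * p = g * ('X^(s * l) - 1) -> forall i, 0 <= g`_i.
Proof.
move=> s0 l0 lo pE cN hD gE.
pose gz (j : int) := if j is Posz i then g`_i else 0.
pose pz (j : int) := c `|j - N%:Z|%N.
have gzE j : gz j = gz (j - (s * l)%N%:Z) + pz j - pz (j - s%:Z).
  case: j => [i|i]; last first.
    rewrite /pz !cN; [|by rewrite NegzE; lia..].
    rewrite addr0 subr0 /=; case E: (_ - _) => [k|k] //.
    by move: E; rewrite NegzE; lia.
  have := congr1 (fun r : {poly int} => r`_i) gE.
  rewrite /= mulrBl mulrBr mul1r mulr1 !coefB coefXnM coefMXn !pE.
  have gT : gz (i%:Z - (s * l)%N%:Z) = if (i < s * l)%N then 0 else g`_(i - s * l).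
    case: ltnP => il; last by rewrite subzn.
    by case E: (_ - _) => [k|k] //; lia.
  have ps : pz (i%:Z - s%:Z) = if (i < s)%N then 0 else c `|(i - s)%N%:Z - N%:Z|%N.
    case: ltnP => il; last by rewrite subzn.
    by rewrite /pz cN //; lia.
  rewrite gT ps; move: (if _ then _ else _) (if _ then _ else _) => a b; rewrite /pz.
  by move: (c _) (g`_i) => u v; lia.
have T0 : (0 < s * l)%N by rewrite muln_gt0 s0.
have [k lk] : exists k, l = k.*2.+1 by exists l./2; rewrite -[LHS]odd_double_half lo.
pose h := (s * k)%N%:Z.
have Th : (s * l)%N%:Z = 2 * h + s%:Z by rewrite lk /h; nia.
pose D m := c m - c (m + s)%N.
have hD' (m : nat) : h <= m%:Z -> 0 <= D m \/ 0 <= D m + D (m + s * l)%N.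
  by move=> hm; apply: hD; rewrite lk /=; move: hm; rewrite /h; nia.
have h0 : 0 <= h by [].
move=> i; rewrite -[g`_i]/(gz i%:Z).
have [iN|iN] := lerP i%:Z (N%:Z - h).
  apply: (@nonneg_recurrence gz D N _ 0 h T0 h0 _ _ hD' _ iN) => [[]//|j jN].
  rewrite gzE /D /pz -addrA; congr (_ + (c _ - c _)); lia.
(* K is the degree expected of g. The reversed sequence j -> g_(K - j) satisfies the same
   recurrence, and each index is at most N - h from one of the two ends. *)
pose K := 2 * N%:Z - 2 * h.
have -> : i%:Z = K - (K - i%:Z) by rewrite opprB addrC subrK.
have iK : K - i%:Z <= N%:Z - h by rewrite /K; lia.
apply: (@nonneg_recurrence (fun j => gz (K - j)) D N _ (size g + `|K|)%N h T0 h0 _ _ hD' _ iK).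
- move=> j; move: (K) => k0 jB; case E: (k0 - j) => [n|n] //; apply: nth_default;
  move: (size g) jB; lia.
- move=> j jN; have := gzE (K - j + (s * l)%N%:Z).
  rewrite addrK (_ : K - (j - (s * l)%N%:Z) = K - j + (s * l)%N%:Z); last by
    rewrite opprB addrA addrAC.
  rewrite /pz /D.
  rewrite (_ : `|(K - j + (s * l)%N%:Z - N%:Z)%R|%N = (`|N%:Z - j| + s)%N); last by
    rewrite Th /K; lia.
  rewrite (_ : `|(K - j + (s * l)%N%:Z - s%:Z - N%:Z)%R|%N = `|N%:Z - j|%N); last by
    rewrite Th /K; lia.
  by move: (gz _) (gz _) (c _) (c _) => a b d e; lia.
Qed.

(** The remainder modulo the monic X^T - 1 stays over the integers, has size at most T and vanishes
    at T distinct algebraic numbers. *)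
Lemma unity_roots_dvd (T : nat) (P : {poly int}) : (0 < T)%N ->
  (forall z : algC, z ^+ T = 1 -> root (map_poly intr P) z) ->
  exists g : {poly int}, P = g * ('X^T - 1).
Proof.
move=> T0 hP; have m : 'X^T - 1 \is @monic int by rewrite monicXnsubC.
exists (Pdiv.Ring.rdivp P ('X^T - 1)); rewrite {1}(Pdiv.RingMonic.rdivp_eq m P).
set r := Pdiv.Ring.rmodp _ _; suff -> : r = 0 by rewrite addr0.
have rs : (size r < T.+1)%N.
  by rewrite -(size_XnsubC (1 : int) T0) Pdiv.Ring.ltn_rmodp monic_neq0.
have fI : injective (intr : int -> algC) by exact: intr_inj.
apply/eqP; apply: contraT => r0.
have {}r0 : map_poly intr r != 0 :> {poly algC}.
  by rewrite -size_poly_eq0 size_map_inj_poly // size_poly_eq0.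
have [w wp] := C_prim_root_exists T0.
have rw z : z ^+ T = 1 -> root (map_poly intr r : {poly algC}) z.
  move=> zT; have := hP z zT; rewrite {1}(Pdiv.RingMonic.rdivp_eq m P) -/r.
  rewrite rmorphD rmorphM rmorphB rmorph1 /= map_polyXn /root hornerD hornerM.
  by rewrite hornerD hornerXn hornerN hornerC zT subrr mulr0 add0r.
have := @max_poly_roots _ (map_poly intr r : {poly algC}) [seq w ^+ i | i <- index_iota 0 T] r0.
rewrite size_map size_iota subn0 size_map_inj_poly // => H.
have /H : all (root (map_poly intr r)) [seq w ^+ i | i <- index_iota 0 T].
  apply/allP => z /mapP[i _ ->]; apply: rw.
  by rewrite exprAC (prim_expr_order wp) expr1n.
suff -> : uniq [seq w ^+ i | i <- index_iota 0 T] by move=> /(_ isT); rewrite ltnNge -ltnS rs.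
rewrite map_inj_in_uniq ?iota_uniq // => i j; rewrite !mem_index_iota !leq0n /= => iT jT.
by move/eqP; rewrite (eq_prim_root_expr wp) !modn_small // => /eqP.
Qed.

Lemma prime_prim_root (F : fieldType) (l : nat) (z : F) :
  prime l -> z ^+ l = 1 -> z != 1 -> l.-primitive_root z.
Proof.
move=> lp zl z1; have [m mp ml] := prim_order_exists (prime_gt0 lp) zl.
case/primeP: lp => _ /(_ m ml) /orP[] /eqP mE; last by rewrite -mE.
by move: z1; rewrite -(prim_expr_order mp) mE expr1 eqxx.
Qed.

Lemma horner_zeta (p : {poly int}) : (map_poly intr p).[zeta] = FracField.tofrac p.
Proof.
rewrite -[in RHS](comp_polyXr p) /comp_poly -horner_map /= -map_poly_comp.
congr (_.[_]); apply: eq_map_poly => n /=.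
by rewrite -[n in n%:P]intz !rmorph_int.
Qed.

Lemma zeta_neq0 : zeta != 0.
Proof. by rewrite tofrac_eq0 polyX_eq0. Qed.

(** Multiplication by X^s - 1 supplies the roots with z^s = 1 and turns Phi_l(X^s) into X^(s l) -
    1. *)
Lemma laurent_nonneg_quotient (s l N : nat) (c : nat -> int) (p : {poly int}) :
  (0 < s)%N -> odd l ->
  (forall i, p`_i = c `|i%:Z - N%:Z|%N) -> (forall m, (N < m)%N -> c m = 0) ->
  (forall m, (s * l.-1 <= 2 * m)%N -> 0 <= c m - c (m + s)%N \/
     0 <= (c m - c (m + s)%N) + (c (m + s * l)%N - c (m + s * l + s)%N)) ->
  (forall z : algC, z ^+ (s * l) = 1 -> z ^+ s != 1 -> (map_poly intr p).[z] = 0) ->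
  laurent_nonneg ((map_poly intr p).[zeta] / zeta ^+ N / Phi l (zeta ^+ s)).
Proof.
move=> s0 lo pE cN hD hz; have l0 := odd_gt0 lo.
have T0 : (0 < s * l)%N by rewrite muln_gt0 s0.
have [|g gE] := @unity_roots_dvd (s * l) (('X^s - 1) * p) T0.
  move=> z zT; rewrite rmorphM rmorphB rmorph1 /= map_polyXn rootM.
  rewrite /root hornerD hornerXn hornerN hornerC subr_eq0.
  by have [//|z1] := eqVneq; rewrite hz //= eqxx.
exists g, N; split; first exact: nonneg_quotient pE cN hD gE.
have z0 := expf_neq0 N zeta_neq0; have P0 := Phi_zeta_neq0 s l0.
have s1 : zeta ^+ s - 1 != 0.
  have -> : zeta ^+ s - 1 = FracField.tofrac ('X^s - 1) by rewrite rmorphB rmorphXn rmorph1.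
  by rewrite tofrac_eq0 monic_neq0 // monicXnsubC.
have := congr1 (fun r => FracField.tofrac r) gE.
have PE : zeta ^+ (s * l) - 1 = (zeta ^+ s - 1) * Phi l (zeta ^+ s) by rewrite exprM subrX1.
rewrite !rmorphM !rmorphB rmorph1 !rmorphXn /= -/zeta PE.
rewrite mulrCA => /(mulfI s1) h.
by rewrite horner_zeta h mulrAC mulfK.
Qed.

Lemma laurent_nonneg_crank5 n :
  laurent_nonneg (crank (5 * n + 4) zeta / Phi 5 (zeta ^+ 2)).
Proof.
set N := (5 * n + 4)%N; rewrite (crankE N zeta_neq0).
apply: (@laurent_nonneg_quotient 2 5 N (crank_count N)) => //.
- exact: coef_crank_poly.
- exact: crank_count_nil.
- move=> m m4; left; rewrite addn2; apply: crank_count_diff2; lia.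
- move=> z z10 z2; have z0 : z != 0.
    by apply/eqP => z0; move: z10; rewrite z0 expr0n => /esym/eqP; rewrite oner_eq0.
  have zp : 5.-primitive_root (z ^+ 2) by apply: prime_prim_root; rewrite // -exprM.
  have Nr : (N %% 5 = 4)%N by rewrite /N; lia.
  have := crank5_vanish zp Nr; rewrite (crankE N z0) => /eqP.
  by rewrite mulf_eq0 invr_eq0 expf_eq0 (negbTE z0) andbF orbF => /eqP.
Qed.

Definition star_poly (l N : nat) : {poly int} :=
  crank_poly N + ('X^(2 * N - l) - 'X^(2 * N) + 'X^l - 1).

(** N <> l keeps the exponents l and 2 N - l apart, and l <= 2 N makes 2 N - l a true
    subtraction. *)
Lemma coef_star_poly l N i : (0 < N)%N -> (N != l) -> (l <= 2 * N)%N ->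
  (star_poly l N)`_i = star_count N l `|i%:Z - N%:Z|%N.
Proof.
move=> N0 Nl lN; rewrite /star_poly coefD coef_crank_poly /star_count !(coefD, coefN, coefXn,
  coef1).
by move: (crank_count _ _) => c; lia.
Qed.

Lemma star_polyE (F : fieldType) l N (z : F) : z != 0 -> (l <= 2 * N)%N ->
  (map_poly intr (star_poly l N)).[z] / z ^+ N =
  crank N z + z ^ (N%:Z - l%:Z) - z ^ N%:Z + z ^ (l%:Z - N%:Z) - z ^ (- N%:Z).
Proof.
move=> z0 lN; have zN := expf_neq0 N z0.
have zD (k : int) j : k + N%:Z = j%:Z -> z ^ k * z ^+ N = z ^+ j.
  by move=> h; rewrite exprnP -expfzDr // h.
have zl : z ^ (N%:Z - l%:Z) * z ^+ N = z ^+ (2 * N - l) by apply: zD; lia.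
have z2N : z ^ N%:Z * z ^+ N = z ^+ (2 * N) by apply: zD; lia.
have zlN : z ^ (l%:Z - N%:Z) * z ^+ N = z ^+ l by apply: zD; lia.
have z1 : z ^ (- N%:Z) * z ^+ N = 1 by rewrite (@zD _ 0%N) //; lia.
have P : crank N z * z ^+ N = (map_poly intr (crank_poly N)).[z] by rewrite crankE // divfK.
apply: (canLR (mulfK zN)); rewrite /star_poly !(rmorphD, rmorphN, rmorph1) /= !map_polyXn.
by rewrite !hornerE !mulrDl !mulNr z1 -P zl z2N zlN. 
Qed.

Lemma laurent_nonneg_star l n : prime l -> odd l ->
  let N := (l * n + beta l)%N in
  (0 < beta l < l)%N -> (l < 2 * beta l)%N ->
  (forall m, (l.-1 <= 2 * m)%N -> 
    let M := star_count N l in 0 <= M m - M m.+1 \/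
     0 <= (M m - M m.+1) + (M (m + l)%N - M (m + l).+1)) ->
  (forall z : algC, l.-primitive_root z -> crank N z = 0) ->
  laurent_nonneg (crank_star l n zeta / Phi l zeta).
Proof.
move=> lp lo N bl lb hM hz.
have lN : (l <= 2 * N)%N by rewrite /N; nia.
have Nl : N != l.
  by apply/eqP => /(congr1 (modn^~ l)); rewrite /N modnn mulnC modnMDl modn_small; lia.
have N0 : (0 < N)%N by rewrite /N; lia.
rewrite -[crank_star l n zeta]star_polyE ?zeta_neq0 // -/N.
rewrite -[X in Phi l X]expr1.
apply: (@laurent_nonneg_quotient 1 l N (star_count N l)) => //.
- by move=> i; apply: coef_star_poly.
- by move=> m mN; rewrite /star_count crank_count_nil //; lia.
- by move=> m; rewrite !mul1n !addn1; apply: hM.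
move=> z; rewrite mul1n expr1 => zl z1.
have zp := prime_prim_root lp zl z1; have z0 := prim_neq0 zp.
have := hz z zp; rewrite (crankE N z0) => /eqP.
rewrite mulf_eq0 invr_eq0 expf_eq0 (negbTE z0) andbF orbF => /eqP pz.
rewrite /star_poly !(rmorphD, rmorphN, rmorph1) /= !map_polyXn.
(* The correction z^(2 N - l) (1 - z^l) - (1 - z^l) vanishes when z^l = 1. *)
have -> : 'X^(2 * N) = 'X^(2 * N - l) * 'X^l :> {poly algC} by rewrite -exprD subnK.
rewrite hornerD pz add0r !(hornerD, hornerN, hornerM, hornerXn, hornerC) zl; ring.
Qed.

Theorem theorem1p3 (n : nat) :
  laurent_nonneg (crank (5 * n + 4) zeta / Phi 5 (zeta ^+ 2)) /\
  [/\ laurent_nonneg (crank_star 5 n zeta / Phi 5 zeta),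
      laurent_nonneg (crank_star 7 n zeta / Phi 7 zeta) &
      laurent_nonneg (crank_star 11 n zeta / Phi 11 zeta)].
Proof.
split; first exact: laurent_nonneg_crank5.
split; apply: laurent_nonneg_star => //;
  rewrite -?[beta 5]/4%N -?[beta 7]/5%N -?[beta 11]/6%N.
- by move=> m m2; apply: star_count5; lia.
(* Squaring permutes the primitive fifth roots of unity, so the vanishing used for (a) covers this
   case. *)
- by move=> z zp; apply: crank5_vanish; [rewrite prim_root_exp_coprime | lia].
- by move=> m m3; left; apply: star_count7; lia.
- by move=> z zp; apply: crank7_vanish => //; lia.
- by move=> m m5; left; apply: star_count11; lia.
- by move=> z zp; apply: crank11_vanish => //; lia.
Qed.
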